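(* There exist absolute constants $C,c>0$ such that for every $n\ge2$ and every $k$-HST $M$ on $n$ points with $k\ge C\log^2 n$, every randomized online algorithm for the metrical task system on $M$ that is $r$-competitive against oblivious adversaries satisfies $r\ge c\log n$. (That is, on an $\Omega(\log^2 n)$-HST on $n$ points the randomized competitive ratio of MTS is $\Omega(\log n)$.)
   Context: For $k\ge1$, a $k$-HST is a metric space defined on the leaves of a rooted tree $T$, where each vertex $u$ carries a label $\Delta(u)\ge0$ with $\Delta(u)=0$ iff $u$ is a leaf, and if $u$ is a child of $v$ then $\Delta(u)\le\Delta(v)/k$; the distance between leaves $x,y$ is $\Delta(\mathrm{lca}(x,y))$. Metrical task system (MTS) on a finite metric space $(V,d)$, $V=\{v_1,\dots,v_b\}$: an algorithm occupies a point (starting from a given initial point) and receives tasks $(c_1,\dots,c_b)\in(\mathbb{R}_{\ge0}\cup\{\infty\})^b$; when at $v_i$ it may move to $v_j$ paying $d(v_i,v_j)+c_j$; costs add up over the sequence. Online algorithms decide based only on tasks seen so far. $\mathrm{cost}_{\mathrm{OPT}}(\sigma)$ is the minimum offline cost from the initial point. A randomized online algorithm $A$ is $r$-competitive against oblivious adversaries if there is a constant $c'$ with $\mathbb{E}[\mathrm{cost}_A(\sigma)]\le r\,\mathrm{cost}_{\mathrm{OPT}}(\sigma)+c'$ for every task sequence $\sigma$. *)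

(* Defs.v *)
From HB Require Import structures.
From mathcomp Require Import all_boot all_order all_algebra.
From mathcomp Require Import all_classical all_reals all_analysis.

Set Implicit Arguments.
Unset Strict Implicit.
Unset Printing Implicit Defensive.

Import Order.TTheory GRing.Theory Num.Theory.
Local Open Scope ring_scope.

(* A finite rooted tree, given by its parent map; the root is made its own
   parent, and [fconnect parent v u] says that [u] is an ancestor of [v] (every
   vertex being an ancestor of itself). *)
Record rooted_tree := RootedTree {
  vertex :> finType;
  root : vertex;
  parent : vertex -> vertex;
  parent_root : parent root = root;
  root_ancestor : forall v : vertex, fconnect parent v root }.

Definition is_child (T : rooted_tree) (u v : T) : bool :=
  (u != root T) && (parent u == v).

Definition is_leaf (T : rooted_tree) (v : T) : bool :=
  [forall u : T, ~~ is_child u v].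

Definition ancestor (T : rooted_tree) (u v : T) : bool :=
  fconnect (@parent T) v u.

Definition is_lca (T : rooted_tree) (w u v : T) : bool :=
  [&& ancestor w u, ancestor w v &
      [forall a : T, ancestor a u && ancestor a v ==> ancestor a w]].

(* The default value [root T] is never used, see [lcaP]. *)
Definition lca (T : rooted_tree) (u v : T) : T :=
  odflt (root T) [pick w | is_lca w u v].

Lemma lcaP (T : rooted_tree) (u v : T) : is_lca (lca u v) u v.
Proof.
rewrite /lca; case: pickP => //= no_lca.
have exP : exists m, ancestor (iter m (@parent T) u) v.
  exists (findex (@parent T) u (root T)).
  by rewrite (iter_findex (root_ancestor u)) /ancestor root_ancestor.
case: (ex_minnP exP) => m mv min_m.
have := no_lca (iter m (@parent T) u).
rewrite /is_lca mv /ancestor fconnect_iter /= => /negP[].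
apply/forallP => a; apply/implyP => /andP[ua va].
have E := iter_findex ua; have := min_m (findex (@parent T) u a).
rewrite /ancestor E => /(_ va) le_m.
by rewrite -E -(subnK le_m) iterD fconnect_iter.
Qed.

Lemma is_lca_uniq (T : rooted_tree) (u v w w' : T) :
  is_lca w u v -> is_lca w' u v -> w = w'.
Proof.
move=> /and3P[wu wv /forallP mw] /and3P[wu' wv' /forallP mw'].
have := mw w'; have := mw' w; rewrite wu wv wu' wv' /= /ancestor => w'w ww'.
have root_iter j : iter j (@parent T) (root T) = root T.
  by elim: j => //= j ->; rewrite parent_root.
have := iter_findex w'w; have := iter_findex ww'.
set i := findex _ w w'; set j := findex _ w' w => Ei Ej.
have [i0|i_gt0] := posnP i; first by rewrite -Ei i0.
(* w lies on a cycle of the parent map, hence w is the root *)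
have loop : iter (j + i) (@parent T) w = w by rewrite iterD Ei Ej.
have loops m : iter (m * (j + i)) (@parent T) w = w.
  by elim: m => // m IHm; rewrite mulSn iterD IHm loop.
have := iter_findex (root_ancestor w); set h := findex _ w _ => Eh.
have w_root : w = root T.
  rewrite -(loops h) -(@subnK h (h * (j + i))) ?iterD ?Eh ?root_iter //.
  by rewrite leq_pmulr // addn_gt0 i_gt0 orbT.
by rewrite -Ei w_root root_iter.
Qed.

Definition hst_labelling (R : realType) (k : R) (T : rooted_tree)
    (Delta : T -> R) : Prop :=
  [/\ forall u : T, 0 <= Delta u,
      forall u : T, Delta u = 0 <-> is_leaf u &
      forall u v : T, is_child u v -> Delta u <= Delta v / k].

(* The points of the space are identified with the leaves by [leaf]. *)
Definition is_HST (R : realType) (k : R) (M : finType) (d : M -> M -> R) :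
    Prop :=
  exists (T : rooted_tree) (Delta : T -> R) (leaf : M -> T),
    [/\ hst_labelling k Delta,
        injective leaf,
        forall v : T, is_leaf v <-> exists x : M, leaf x = v &
        forall x y : M, d x y = Delta (lca (leaf x) (leaf y))].

Section MetricalTaskSystem.
Context {R : realType} {M : finType}.
Implicit Types (d : M -> M -> R) (x : M).

(* The costs range over [0, +oo], with +oo included. *)
Definition task : Type := M -> {nonneg \bar R}.

(* Cost of serving the tasks [s], starting at [x], by successively moving to the
   points of [p]; only used when [s] and [p] have the same size. *)
Fixpoint schedule_cost d x (s : seq task) (p : seq M) : \bar R :=
  match s, p with
  | c :: s', y :: p' =>
      ((d x y)%:E + (c y)%:num + schedule_cost d y s' p')%E
  | _, _ => 0%E
  end.

Definition cost_OPT d x (s : seq task) : \bar R :=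
  \big[Order.min/+oo%E]_(p : (size s).-tuple M) schedule_cost d x s p.

(* The point occupied after each nonempty sequence of tasks; the value at [::]
   is irrelevant since the initial point is given separately. *)
Definition online_algorithm : Type := seq task -> M.

Definition positions (A : online_algorithm) (s : seq task) : seq M :=
  [seq A (take t.+1 s) | t <- iota 0 (size s)].

Definition cost_online d x (A : online_algorithm) (s : seq task) : \bar R :=
  schedule_cost d x s (positions A s).

(* A random deterministic online algorithm, on an arbitrary probability
   space. *)
Record randomized_algorithm := RandomizedAlgorithm {
  rand_display : measure_display;
  rand_space : measurableType rand_display;
  rand_prob : probability rand_space R;
  rand_alg : rand_space -> online_algorithm;
  rand_measurable : forall (s : seq task) (y : M),
    measurable [set w : rand_space | rand_alg w s = y] }.

Definition expected_cost d x (A : randomized_algorithm) (s : seq task) :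
    \bar R :=
  (\int[rand_prob A]_w cost_online d x (rand_alg w) s)%E.

Definition competitive d x (A : randomized_algorithm) (r : R) : Prop :=
  exists c' : R, forall s : seq task,
    (expected_cost d x A s <= r%:E * cost_OPT d x s + c'%:E)%E.

End MetricalTaskSystem.

Arguments task : clear implicits.
Arguments online_algorithm : clear implicits.
Arguments randomized_algorithm : clear implicits.

(* Main.v *)
(* Yao's principle reduces the theorem to finding, for every [m], a random
   sequence of requests which costs every online player at least [m] on average,
   but an offline player at most [m / f], with [f] of order [ln n].

   Such adversaries are built by induction on the tree. Consider subspaces at
   mutual distance [Delta], in which adversaries achieve the ratios [f i]. The
   new adversary repeatedly strikes randomly chosen subspaces, for amounts of at
   most [Delta / 2], with odds such that an online player loses as much on
   average in each subspace. Moving away does not help her, because what is at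
   stake in a strike never exceeds [Delta]: the adversary of a subspace is worth
   at most O(f ^ 2) times its diameter, whence the hypothesis on [k]. The offline
   player moves to a subspace which happens to be struck less than its share.
   With [2 ^ h] subspaces of equal ratio, the fluctuations of [h] random walks,
   one for each bit of the index, improve the ratio by order [h]; with two
   subspaces of ratios [f1 >= f2], a gambler's ruin improves [f1] by order
   [exp (- 16 * (f1 - f2))]. One of the two constructions always lets the ratio
   grow like [1 + c * ln a], for [a] the number of points. *)
From mathcomp Require Import all_boot all_order all_algebra.
From mathcomp Require Import all_classical all_reals all_analysis.
From mathcomp Require Import measurable_realfun.
From mathcomp Require Import ring lra zify.
Require Import Defs.

Set Implicit Arguments.
Unset Strict Implicit.
Unset Printing Implicit Defensive.

Import Order.TTheory GRing.Theory Num.Theory.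
Local Open Scope ring_scope.

(** * Adversaries and their value *)

Section Adversaries.
Variables (R : realType) (M : finType).
Implicit Types T : {set M}.

(** A finite tree of coin tosses, so that averages are finite sums and need no probability space.
    That the biases are probabilities is left to [wf]. *)
Inductive adversary :=
  | Stop
  | Hit of M * R & adversary
  | Coin of R & adversary & adversary.

Fixpoint wf (D : adversary) : bool :=
  match D with
  | Stop => true
  | Hit _ D' => wf D'
  | Coin p D1 D2 => [&& 0 <= p, p <= 1, wf D1 & wf D2]
  end.

Fixpoint inside T (D : adversary) : bool :=
  match D with
  | Stop => true
  | Hit q D' => (q.1 \in T) && inside T D'
  | Coin _ D1 D2 => inside T D1 && inside T D2
  end.

Fixpoint andthen (D1 D2 : adversary) : adversary :=
  match D1 with
  | Stop => D2
  | Hit q D => Hit q (andthen D D2)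
  | Coin p Da Db => Coin p (andthen Da D2) (andthen Db D2)
  end.

Fixpoint expect (D : adversary) (F : seq (M * R) -> R) : R :=
  match D with
  | Stop => F [::]
  | Hit q D' => expect D' (fun s => F (q :: s))
  | Coin p D1 D2 => p * expect D1 F + (1 - p) * expect D2 F
  end.

Lemma wf_andthen D1 D2 : wf D1 -> wf D2 -> wf (andthen D1 D2).
Proof.
elim: D1 => //= p Da IHa Db IHb /and4P[-> -> wa wb] w2 /=.
by rewrite IHa ?IHb.
Qed.

Lemma inside_andthen T D1 D2 :
  inside T D1 -> inside T D2 -> inside T (andthen D1 D2).
Proof.
elim: D1 => //= [q D IH|p Da IHa Db IHb].
  by case/andP=> -> wD w2; rewrite IH.
by case/andP=> wa wb w2; rewrite IHa ?IHb.
Qed.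

Lemma inside_sub T T' D : T \subset T' -> inside T D -> inside T' D.
Proof.
move=> TT'; elim: D => //= [q D IH /andP[qT /IH ->]|
  p Da IHa Db IHb /andP[/IHa-> /IHb->//]].
by rewrite (fintype.subsetP TT').
Qed.

Lemma expect_andthen D1 D2 F : expect (andthen D1 D2) F =
  expect D1 (fun s => expect D2 (fun t => F (s ++ t))).
Proof. by elim: D1 F => //= p Da IHa Db IHb F; rewrite IHa IHb. Qed.

Lemma expect_lin D a b F G :
  expect D (fun s => a * F s + b * G s) = a * expect D F + b * expect D G.
Proof. by elim: D F G => //= p Da IHa Db IHb F G; rewrite IHa IHb; ring. Qed.

Lemma expect_cst D a : expect D (fun=> a) = a.
Proof. by elim: D => //= p Da -> Db ->; ring. Qed.

Lemma expect_addl D a F : expect D (fun s => a + F s) = a + expect D F.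
Proof. by elim: D F => //= p Da IHa Db IHb F; rewrite IHa IHb; ring. Qed.

Lemma expect_swap D1 D2 (F : seq (M * R) -> seq (M * R) -> R) :
  expect D1 (fun s => expect D2 (F s)) =
  expect D2 (fun t => expect D1 (F ^~ t)).
Proof.
elim: D1 F => //= p Da IHa Db IHb F.
by rewrite IHa IHb expect_lin.
Qed.

Lemma le_expect T D F G : wf D -> inside T D ->
  (forall s, all (fun q => q.1 \in T) s -> F s <= G s) ->
  expect D F <= expect D G.
Proof.
elim: D F G => [|q D IH|p Da IHa Db IHb] F G /=; first by move=> _ _; apply.
  move=> wD /andP[qT tD] FG; apply: IH => // s sT; apply: FG.
  by rewrite /= qT.
case/and4P=> p0 p1 wa wb /andP[ta tb] FG.
by rewrite lerD // ler_wpM2l ?subr_ge0 ?IHa ?IHb.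
Qed.

End Adversaries.
Arguments Stop {R M}.

(** * Online values, offline costs and hardness at every scale *)

Section Bellman.
Variables (R : realType) (M : finType) (d : M -> M -> R).
Implicit Types (S T : {set M}) (D : adversary R M) (q : M * R) (x y z : M).

(** The absolute value makes every charge nonnegative, whatever real number a [Hit] carries. *)
Definition charge q y : R := if y == q.1 then `|q.2| else 0.

(* [lower_bound S D Phi Psi]: an online player confined to [S] who starts at [x]
   and is charged [Phi y] for ending at [y] pays at least [Psi x] on average.
   This is Bellman's recursion, with inequalities instead of minima. *)
Fixpoint lower_bound S D (Phi Psi : M -> R) : Prop :=
  match D with
  | Stop => forall x, x \in S -> Psi x <= Phi x
  | Hit q D' => exists2 Chi, lower_bound S D' Phi Chi &
      forall x y, x \in S -> y \in S -> Psi x <= d x y + charge q y + Chi y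
  | Coin p D1 D2 => exists Psi1 Psi2, [/\ lower_bound S D1 Phi Psi1,
      lower_bound S D2 Phi Psi2 &
      forall x, x \in S -> Psi x <= p * Psi1 x + (1 - p) * Psi2 x]
  end.

Lemma lower_bound_le S D Phi Psi Psi' :
  (forall x, x \in S -> Psi' x <= Psi x) ->
  lower_bound S D Phi Psi -> lower_bound S D Phi Psi'.
Proof.
move=> le'; case: D => [|q D|p D1 D2] /=.
- by move=> H x xS; apply: le_trans (le' x xS) (H x xS).
- case=> Chi HD H; exists Chi => // x y xS yS.
  exact: le_trans (le' x xS) (H x y xS yS).
- case=> Psi1 [Psi2 [H1 H2 H]]; exists Psi1, Psi2; split=> // x xS.
  exact: le_trans (le' x xS) (H x xS).
Qed.

Lemma lower_bound_andthen S D1 D2 Phi Chi Psi :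
  lower_bound S D1 Chi Psi -> lower_bound S D2 Phi Chi ->
  lower_bound S (andthen D1 D2) Phi Psi.
Proof.
elim: D1 Psi => [|q D IH|p Da IHa Db IHb] Psi /=.
- by move=> H; apply: lower_bound_le.
- by case=> Chi' H1 H H2; exists Chi' => //; apply: IH.
- case=> Psi1 [Psi2 [H1 H2 H]] HD; exists Psi1, Psi2.
  by split=> //; [apply: IHa|apply: IHb].
Qed.

(* Cost of the best offline player confined to [S] who starts at [x], serves [s]
   and finally moves to [z]; meaningful for [x \in S]. *)
Fixpoint offline S z (s : seq (M * R)) x : R :=
  match s with
  | [::] => d x z
  | q :: s' => let F y := d x y + charge q y + offline S z s' y in
      \big[Num.min/F x]_(y in S) F y
  end.

Hypothesis d_refl : forall x, d x x = 0.
Hypothesis d_sym : forall x y, d x y = d y x.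
Hypothesis d_tri : forall x y z, d x z <= d x y + d y z.

Lemma d_ge0 x y : 0 <= d x y.
Proof. by have := d_tri x y x; rewrite d_refl (d_sym y x); lra. Qed.

Lemma offline_cons_le S z q s x y : y \in S ->
  offline S z (q :: s) x <= d x y + charge q y + offline S z s y.
Proof. by move=> yS /=; apply: bigmin_le_cond. Qed.

Lemma offline_consP S z q s x : x \in S ->
  exists2 y, y \in S &
    offline S z (q :: s) x = d x y + charge q y + offline S z s y.
Proof.
move=> xS /=; pose F y := d x y + charge q y + offline S z s y.
apply: (big_ind (fun v => exists2 y, y \in S & v = F y))
  => [|a b [y yS ->] [z' z'S ->]|y yS].
- by exists x.
- by rewrite minEle; case: ifP => _; [exists y|exists z'].
- by exists y.
Qed.

Lemma charge_ge0 q y : 0 <= charge q y.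
Proof. by rewrite /charge; case: ifP. Qed.

Lemma offline_start S z s x y : x \in S ->
  offline S z s y <= d y x + offline S z s x.
Proof.
case: s => [|q s] xS; first exact: d_tri.
have [y' y'S ->] := offline_consP z q s xS.
apply: le_trans (offline_cons_le z q s y y'S) _.
by have := d_tri y x y'; lra.
Qed.

Lemma offline_cat S s t x y z : x \in S -> y \in S ->
  offline S z (s ++ t) y <= offline S x s y + offline S z t x.
Proof.
elim: s y => [|q s IH] y xS yS; first exact: offline_start.
have [y' y'S ->] := offline_consP x q s yS.
apply: le_trans (offline_cons_le z q (s ++ t) y y'S) _.
by have := IH _ xS y'S; lra.
Qed.

Lemma offline_untouched S T s x : x \in S -> x \notin T ->
  all (fun q => q.1 \in T) s -> offline S x s x <= 0.
Proof.
move=> xS xT; elim: s => [|q s IH]; first by rewrite /= d_refl.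
case/andP=> qT /IH {}IH.
apply: le_trans (offline_cons_le x q s x xS) _.
rewrite d_refl add0r /charge; case: eqP => [xq|_]; last by rewrite add0r.
by rewrite xq qT in xT.
Qed.

Lemma offline_detour S s x y : x \in S -> y \in S ->
  offline S x s x <= 2 * d x y + offline S y s y.
Proof.
move=> xS yS; have := offline_start x s x yS.
have := @offline_cat S s [::] y y x yS yS; rewrite cats0 /= (d_sym y x); lra.
Qed.

Definition bump T (v : R) x : R := if x \in T then v else 0.

(* On [T], the adversary [D] costs an online player [v] on average, wherever
   she starts and whatever she does, provided that leaving [T] is never
   worth more than [G]. *)
Definition extorts T D (v G : R) : Prop :=
  forall S (Phi : M -> R) (phi : R), T \subset S ->
    (forall x y, x \in S -> y \in S -> Phi x <= Phi y + d x y) ->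
    (forall x, x \in T -> Phi x = phi) ->
    (forall x y, x \in T -> y \in S -> y \notin T -> phi + G <= Phi y + d x y) ->
  lower_bound S D Phi (fun x => Phi x + bump T v x).

(* At every scale [u], some adversary costs online players [u] but an offline
   player only [u / f], starting from and returning to [x]. *)
Definition hard T x (f G : R) : Prop :=
  x \in T /\ forall u, 0 <= u -> exists D, [/\ wf D, inside T D,
    extorts T D u (u + G) &
    forall S, T \subset S -> expect D (fun s => offline S x s x) <= u / f].

Lemma extorts_le T D v G G' : G <= G' -> extorts T D v G -> extorts T D v G'.
Proof.
move=> GG' H S Phi phi TS Lip cst slack.
apply: (H S Phi phi) => // x y xT yS yT.
by have := slack x y xT yS yT; lra.
Qed.

(** [D1] is played against the final charge [Phi] raised by [v2] on [T]. This charge is still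
    1-Lipschitz because leaving [T] gains at most [v2 <= G]. The slack left for [D1] drops by [v2],
    whence [v2 + G1 <= G]. *)
Lemma extorts_andthen T D1 D2 v1 v2 G G1 G2 : extorts T D1 v1 G1 ->
  extorts T D2 v2 G2 -> 0 <= v2 -> v2 <= G -> G2 <= G -> v2 + G1 <= G ->
  extorts T (andthen D1 D2) (v1 + v2) G.
Proof.
move=> H1 H2 v20 v2G G2G v2G1 S Phi phi TS Lip cst slack.
apply: (@lower_bound_andthen _ _ _ _ (fun x => Phi x + bump T v2 x)); last first.
  by have := (extorts_le G2G H2); move=> /(_ S Phi phi); apply.
apply: (@lower_bound_le _ _ _ (fun x => Phi x + bump T v2 x + bump T v1 x)).
  by move=> x xS; rewrite /bump; case: ifP => _; lra.
apply: (H1 S _ (phi + v2)) => //.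
- move=> x y xS yS; have := Lip x y xS yS; rewrite /bump.
  case: ifP => xT; case: ifP => yT; try lra.
  by move=> _; rewrite (cst x xT); have := slack x y xT yS (negbT yT); lra.
- by move=> x xT; rewrite /bump xT cst.
- move=> x y xT yS yT; have := slack x y xT yS yT.
  by rewrite /bump (negbTE yT); lra.
Qed.

Lemma extorts_coin T p D1 D2 v1 v2 G : extorts T D1 v1 G ->
  extorts T D2 v2 G -> extorts T (Coin p D1 D2) (p * v1 + (1 - p) * v2) G.
Proof.
move=> H1 H2 S Phi phi TS Lip cst slack /=.
exists (fun x => Phi x + bump T v1 x), (fun x => Phi x + bump T v2 x).
split; [exact: (H1 S Phi phi)|exact: (H2 S Phi phi)|].
by move=> x xS; rewrite /bump; case: ifP => _; lra.
Qed.

Lemma extorts_stop T : extorts T Stop 0 0.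
Proof.
by move=> S Phi phi TS Lip cst slack x xS; rewrite /bump; case: ifP; rewrite addr0.
Qed.

(** One hit of [u] suffices: an online player at [x] pays it or escapes, which costs no less by the
    slack. An offline player who stays pays [u] too, hence the ratio 1. *)
Lemma hard_leaf x : hard [set x] x 1 0.
Proof.
split; first by rewrite inE.
move=> u u0; exists (Hit (x, u) Stop); split=> //=; first by rewrite inE eqxx.
- move=> S Phi phi TS Lip cst slack; exists Phi => // y z yS zS.
  have xS : x \in S by rewrite (fintype.subsetP TS) ?inE.
  have := Lip y z yS zS; have := d_ge0 y z; rewrite /bump /charge /= inE.
  rewrite (ger0_norm u0).
  have [->|yx] := eqVneq y x; have [->|zx] := eqVneq z x; rewrite ?d_refl; try lra.
  have xT : x \in [set x] by rewrite inE.
  rewrite (cst x xT); have := slack x z xT zS; rewrite inE => /(_ zx); lra.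
- move=> S TS; have xS : x \in S by rewrite (fintype.subsetP TS) ?inE.
  have := offline_cons_le x (x, u) [::] x xS.
  by rewrite /= d_refl /charge /= eqxx (ger0_norm u0) divr1; lra.
Qed.

(* Tossing a biased coin before playing [D] makes its cost arbitrarily small
   at no loss in the ratio; repetition then gives every scale. *)
Lemma hard_of_extorts T x f g G D : x \in T -> 0 < g -> 0 < f -> 0 <= G ->
  wf D -> inside T D -> extorts T D g G ->
  (forall S, T \subset S -> expect D (fun s => offline S x s x) <= g / f) ->
  hard T x f G.
Proof.
move=> xT g0 f0 G0 wD tD lbD ubD; split=> // u u0.
(* [m] rounds, each played with probability [eps], add up to exactly [u]; [m >= u / g] makes [eps] a
   probability. *)
pose m := (Num.truncn (u / g)).+1; pose eps := u / (m%:R * g).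
have m0 : 0 < m%:R :> R by rewrite ltr0n.
have um : u / g <= m%:R by apply/ltW/truncnS_gt.
have eps0 : 0 <= eps by rewrite divr_ge0 // mulr_ge0 // ltW.
have eps1 : eps <= 1.
  by rewrite /eps ler_pdivrMr ?mulr_gt0 // mul1r -ler_pdivrMr.
have epsm : m%:R * (eps * g) = u.
  by rewrite /eps; field; rewrite !gt_eqF.
pose D1 := Coin eps D Stop.
have lb1 : extorts T D1 (eps * g) G.
  have -> : eps * g = eps * g + (1 - eps) * 0 by ring.
  by apply: extorts_coin => //; apply: extorts_le (@extorts_stop T).
pose It j := iter j (andthen D1) Stop.
have eg0 : 0 <= eps * g by rewrite mulr_ge0 // ltW.
have It_lb j : (j <= m)%N -> extorts T (It j) (j%:R * (eps * g)) (u + G).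
  elim: j => [_|j IH jm].
    by rewrite mul0r; apply: extorts_le (@extorts_stop T); rewrite addr_ge0.
  have ju : j.+1%:R * (eps * g) <= u by rewrite -epsm ler_wpM2r // ler_nat.
  have ju' : j%:R * (eps * g) + eps * g <= u.
    by move: ju; rewrite -natr1 mulrDl mul1r.
  rewrite -natr1 mulrDl mul1r addrC.
  apply: (extorts_andthen lb1 (IH (ltnW jm))) => //; try lra.
  by rewrite mulr_ge0.
have It_wf j : wf (It j) && inside T (It j).
  elim: j => // j; rewrite /It /= => /andP[wj tj].
  by rewrite eps0 eps1 wf_andthen // inside_andthen // wj tj.
have It_ub S j : T \subset S ->
    expect (It j) (fun s => offline S x s x) <= j%:R * (eps * (g / f)).
  move=> TS; have xS : x \in S by rewrite (fintype.subsetP TS).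
  have /andP[wj tj] := It_wf j.
  elim: j wj tj => [_ _|j IH wj tj] /=; first by rewrite d_refl mul0r.
  have /andP[{}wj {}tj] := It_wf j; have {}IH := IH wj tj.
  have one : expect (andthen D (It j)) (fun s => offline S x s x)
      <= g / f + expect (It j) (fun s => offline S x s x).
    rewrite expect_andthen.
    apply: (@le_trans _ _ (expect D (fun s => offline S x s x +
       expect (It j) (fun s => offline S x s x)))).
      apply: (le_expect wD tD) => s _; rewrite -expect_addl.
      by apply: (le_expect wj tj) => t _; apply: offline_cat.
    rewrite (_ : expect D _ = expect D (fun s => offline S x s x) +
       expect (It j) (fun s => offline S x s x)); last first.
      by rewrite addrC -expect_addl; congr expect; apply/funext => s; rewrite addrC.
    by rewrite lerD2r ubD.
  have -> : j.+1%:R * (eps * (g / f)) = eps * (g / f + j%:R * (eps * (g / f)))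
       + (1 - eps) * (j%:R * (eps * (g / f))) by rewrite -natr1; ring.
  apply: lerD; apply: ler_wpM2l => //; last by rewrite subr_ge0.
  by apply: le_trans one _; rewrite lerD2l.
exists (It m); have /andP[wm tm] := It_wf m; split=> //.
  by have := It_lb m (leqnn m); rewrite epsm.
move=> S TS; apply: le_trans (It_ub S m TS) _.
by rewrite -epsm !mulrA.
Qed.
End Bellman.

(** * Combining subspaces at equal distances *)

Section Node.
Variables (R : realType) (M : finType) (d : M -> M -> R).
Hypothesis d_refl : forall x, d x x = 0.
Hypothesis d_sym : forall x y, d x y = d y x.
Hypothesis d_tri : forall x y z, d x z <= d x y + d y z.
Variables (I : finType) (i0 : I) (B : I -> {set M}) (home : I -> M).
Variables (f : I -> R) (Delta : R).
Hypothesis Delta_gt0 : 0 < Delta.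
Hypothesis B_hard : forall i, hard d (B i) (home i) (f i) (Delta / 2).
Hypothesis B_dist : forall i j x y,
  i != j -> x \in B i -> y \in B j -> d x y = Delta.
Implicit Types (S : {set M}) (D : adversary R M) (n : I -> R).

Let T := \bigcup_i B i.

Let home_B i : home i \in B i. Proof. by case: (B_hard i). Qed.

Lemma B_disj i j x : x \in B i -> x \in B j -> i = j.
Proof.
move=> xi xj; apply/eqP; apply: contraT => ij.
by have := B_dist ij xi xj; rewrite d_refl => D0; move: Delta_gt0; rewrite -D0 ltxx.
Qed.

Lemma B_sub i S : T \subset S -> B i \subset S.
Proof. by apply: fintype.subset_trans; apply: finset.bigcup_sup. Qed.

Lemma home_in i S : T \subset S -> home i \in S.
Proof. by move=> TS; apply: (fintype.subsetP (B_sub i TS)). Qed.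

Lemma B_in i x : x \in B i -> x \in T.
Proof. by move=> xi; apply/finset.bigcupP; exists i. Qed.

(** An offline player with a single base [home i], where [n i] is the debt already accumulated
    there. The base is chosen with full knowledge of [s]. *)
Definition best S n (s : seq (M * R)) : R :=
  \big[Num.min/n i0 + offline d S (home i0) s (home i0)]_i
     (n i + offline d S (home i) s (home i)).

Lemma best_le S n s i : best S n s <= n i + offline d S (home i) s (home i).
Proof. exact: bigmin_le_cond. Qed.

Lemma le_best S n s a :
  (forall i, a <= n i + offline d S (home i) s (home i)) -> a <= best S n s.
Proof. by move=> H; apply: le_bigmin => // i _; apply: H. Qed.

Definition struck (l : seq I) x := has (fun i => x \in B i) l.

Lemma struckE l i x : x \in B i -> struck l x = (i \in l).
Proof.
move=> xi; apply/hasP/idP => [[j jl xj]|il]; last by exists i.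
by rewrite (B_disj xi xj).
Qed.

(** The subspaces of [l] are attacked one after the other at scale [u]. Fleeing to another subspace
    costs [Delta], which covers both the stake [u <= Delta / 2] and the slack [Delta / 2] in the
    hardness assumption. An offline player is only hurt by the attack on her own base. *)
Lemma strike (l : seq I) u : uniq l -> 0 <= u <= Delta / 2 ->
  exists H : adversary R M,
  [/\ wf H, inside T H,
     forall S (Phi : M -> R) (phi : R), T \subset S ->
       (forall x y, x \in S -> y \in S -> Phi x <= Phi y + d x y) ->
       (forall x, x \in T -> Phi x = phi) ->
       (forall x y, x \in T -> y \in S -> y \notin T ->
          phi + Delta <= Phi y + d x y) ->
       lower_bound d S H Phi (fun x => Phi x + if struck l x then u else 0) &
     forall S D n, T \subset S -> wf D -> inside T D ->
       expect (andthen H D) (best S n)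
       <= expect D (best S (fun i => n i + if i \in l then u / f i else 0))].
Proof.
move=> + /andP[u0 uD]; elim: l => [_|i l IH /andP[il /IH[H [wH tH lbH ubH]]]].
  exists Stop; split=> //= [S Phi phi TS Lip cst slack x xS|S D n TS wD tD].
    by rewrite addr0.
  by rewrite (_ : (fun i => _) = n) //; apply/funext => i; rewrite addr0.
have [_ /(_ u u0)[K [wK tK lbK ubK]]] := B_hard i.
have BT : B i \subset T by apply: finset.bigcup_sup.
have tK' : inside T K by apply: inside_sub tK.
exists (andthen K H); split; [exact: wf_andthen|exact: inside_andthen| |].
- move=> S Phi phi TS Lip cst slack.
  (* Value of the strikes still to come, which serves as the final charge for [K]. *)
  pose Chi x := Phi x + if struck l x then u else 0.
  apply: (@lower_bound_andthen _ _ _ _ _ _ _ Chi); last first.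
    exact: (lbH S Phi phi TS Lip cst slack).
  have Chi_ge x : Phi x <= Chi x by rewrite /Chi; case: ifP => _; lra.
  have Chi_le x : Chi x <= Phi x + u by rewrite /Chi; case: ifP => _; lra.
  have Chi_out x : x \notin T -> Chi x = Phi x.
    move=> xT; rewrite /Chi; case: ifP; last by rewrite addr0.
    case/hasP => j _ xj; case/negP: xT; exact: B_in xj.
  have Chi_in j x : x \in B j -> Chi x = phi + if j \in l then u else 0.
    by move=> xj; rewrite /Chi (struckE l xj) (cst _ (B_in xj)).
  have Chi_Lip x y : x \in S -> y \in S -> Chi x <= Chi y + d x y.
    move=> xS yS; have := Lip x y xS yS => Lxy.
    have [xT|xT] := boolP (x \in T); last first.
      by rewrite (Chi_out x xT); have := Chi_ge y; lra.
    have [yT|yT] := boolP (y \in T); last first.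
      rewrite (Chi_out y yT); have := slack x y xT yS yT; have := Chi_le x.
      by rewrite cst //; lra.
    case/finset.bigcupP: xT => j _ xj; case/finset.bigcupP: yT => k _ yk.
    have [jk|jk] := eqVneq j k.
      by rewrite (Chi_in _ _ xj) (Chi_in _ _ yk) jk lerDl d_ge0.
    have xT := B_in xj.
    have := Chi_le x; have := Chi_ge y; rewrite (B_dist jk xj yk).
    have yT := B_in yk.
    by rewrite !cst //; lra.
  apply: (@lower_bound_le _ _ _ _ _ _ (fun x => Chi x + bump (B i) u x)); last first.
    apply: (lbK S Chi phi) => //.
    + exact: B_sub.
    + by move=> x xi; rewrite (Chi_in _ _ xi) (negbTE il) addr0.
    + move=> x y xi yS yi; have xT : x \in T by apply: (fintype.subsetP BT).
      have [yT|yT] := boolP (y \in T); last first.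
        by rewrite (Chi_out y yT); have := slack x y xT yS yT; lra.
      case/finset.bigcupP: (yT) => k _ yk.
      have ik : i != k by apply: contraNneq yi => ->.
      by rewrite (B_dist ik xi yk); have := Chi_ge y; rewrite cst //; lra.
  move=> x xS; rewrite /bump /Chi /=.
  case: (boolP (x \in B i)) => xi /=; last lra.
  by rewrite (struckE l xi) (negbTE il); lra.
- move=> S D n TS wD tD.
  set n' := fun j => n j + if j \in i :: l then u / f j else 0.
  pose n1 j := n j + if j == i then u / f i else 0.
  have -> : n' = (fun j => n1 j + if j \in l then u / f j else 0).
    apply/funext => j; rewrite /n' /n1 inE; have [->|_] /= := eqVneq j i.
      by rewrite (negbTE il) addr0.
    by rewrite addr0.
  apply: le_trans (ubH S D n1 TS wD tD).
  have wHD := wf_andthen wH wD; have tHD := inside_andthen tH tD.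
  rewrite (_ : andthen (andthen K H) D = andthen K (andthen H D)); last first.
    by elim: K {wK tK lbK ubK tK'} => //= [q K ->|p K1 -> K2 ->].
  (* The tosses of [K] are independent of those of [E], so they can be averaged first, for each
     fixed continuation [t]. *)
  move: (andthen H D) wHD tHD => E wE tE; rewrite expect_andthen expect_swap.
  apply: (le_expect wE tE) => t _; apply: le_best => j.
  apply: (@le_trans _ _ (expect K (fun s =>
     (n j + offline d S (home j) t (home j)) +
     if j == i then offline d S (home i) s (home i) else 0))).
    apply: (le_expect wK tK) => s sB; apply: le_trans (best_le _ _ _ j) _.
    have jS := home_in j TS.
    have := @offline_cat _ _ _ d_tri S s t (home j) (home j) (home j) jS jS.
    have [->|ji] := eqVneq j i; first lra.
    suff : offline d S (home j) s (home j) <= 0 by lra.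
    apply: (@offline_untouched _ _ _ d_refl S (B i)) => //.
    by apply: contraNN ji => /(B_disj (home_B j)) ->.
  rewrite expect_addl /n1; have [->|ji] := eqVneq j i.
    by have := ubK S (B_sub i TS); lra.
  by rewrite expect_cst; lra.
Qed.

Definition plays D v G := [/\ wf D, inside T D & extorts d T D v G].

Lemma plays_stop G : 0 <= G -> plays Stop 0 G.
Proof. by move=> G0; split=> //; apply: extorts_le (@extorts_stop _ _ d T). Qed.

Lemma best_stop S n i : expect Stop (best S n) <= n i.
Proof. by have := best_le S n [::] i; rewrite /= d_refl addr0. Qed.

(** Using another base [home j] takes a round trip, entered as an initial debt of [2 * Delta]. *)
Lemma offline_best S s i : T \subset S ->
  offline d S (home i) s (home i) <=
  best S (fun j => if j == i then 0 else 2 * Delta) s.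
Proof.
move=> TS; apply: le_best => j; have [->|ji] := eqVneq j i; first by rewrite add0r.
have := offline_detour d_sym d_tri s (home_in i TS) (home_in j TS).
by rewrite eq_sym in ji; rewrite (B_dist ji (home_B i) (home_B j)).
Qed.

(* A balanced toss decides which of two complementary families of subspaces is
   charged, so that the online player loses the same amount wherever she is. *)
Lemma coin_step (A : pred I) p u1 u2 D1 D2 v1 v2 G :
    0 <= p <= 1 -> 0 <= u1 <= Delta / 2 -> 0 <= u2 <= Delta / 2 ->
    p * u1 = (1 - p) * u2 -> 0 <= v1 -> 0 <= v2 ->
    v1 + Delta <= G -> v2 + Delta <= G -> plays D1 v1 G -> plays D2 v2 G ->
  exists2 D, plays D (p * v1 + (1 - p) * v2 + p * u1) G &
    forall S n, T \subset S -> expect D (best S n) <=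
      p * expect D1 (best S (fun i => n i + if A i then u1 / f i else 0)) +
      (1 - p) * expect D2 (best S (fun i => n i + if A i then 0 else u2 / f i)).
Proof.
move=> /andP[p0 p1] hu1 hu2 bal v10 v20 v1G v2G [w1 t1 l1] [w2 t2 l2].
have [H1 [wH1 tH1 lH1 uH1]] := strike (enum_uniq A) hu1.
have [H2 [wH2 tH2 lH2 uH2]] := strike (enum_uniq (predC A)) hu2.
exists (Coin p (andthen H1 D1) (andthen H2 D2)).
  split=> /=.
  - by rewrite p0 p1 !wf_andthen.
  - by rewrite !inside_andthen.
  - move=> S Phi phi TS Lip cst slack.
    have lb H D u v (l : seq I) :
        (forall (Psi : M -> R) (psi : R),
          (forall x y, x \in S -> y \in S -> Psi x <= Psi y + d x y) ->
          (forall x, x \in T -> Psi x = psi) ->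
          (forall x y, x \in T -> y \in S -> y \notin T ->
             psi + Delta <= Psi y + d x y) ->
          lower_bound d S H Psi (fun x => Psi x + if struck l x then u else 0)) ->
        extorts d T D v G -> 0 <= v -> v + Delta <= G ->
      lower_bound d S (andthen H D) Phi
        (fun x => Phi x + bump T v x + if struck l x then u else 0).
      move=> lbH lbD v0 vG.
      apply: (lower_bound_andthen _ (lbD S Phi phi TS Lip cst slack)).
      apply: (lbH _ (phi + v)) => [x y xS yS|x xT|x y xT yS yT].
      - have := Lip x y xS yS; rewrite /bump.
        case: (boolP (x \in T)) => xT; case: (boolP (y \in T)) => yT /=; try lra.
        by have := slack x y xT yS yT; rewrite (cst x xT); move: Delta_gt0; lra.
      - by rewrite /bump xT cst.
      - by have := slack x y xT yS yT; rewrite /bump (negbTE yT); lra.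
    have := lb H2 D2 u2 v2 _ (fun Psi psi => lH2 S Psi psi TS) l2 v20 v2G.
    have := lb H1 D1 u1 v1 _ (fun Psi psi => lH1 S Psi psi TS) l1 v10 v1G.
    move=> L1 L2; do 2 eexists; split; [exact: L1|exact: L2|].
    move=> x xS; rewrite /bump; case: (boolP (x \in T)) => xT.
      (* The point lies in a single subspace, hence in one of the two families, and the balance of
         the toss makes the two expected losses equal. *)
      case/finset.bigcupP: (xT) => i _ xi.
      rewrite !(struckE _ xi) !mem_enum /in_mem /=.
      by case: (A i) => /=; lra.
    have nostruck l : struck l x = false.
      by apply/hasP => -[i _ xi]; rewrite (B_in xi) in xT.
    by rewrite !nostruck; lra.
move=> S n TS /=; apply: lerD; apply: ler_wpM2l; rewrite ?subr_ge0 //.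
  apply: le_trans (uH1 S D1 n TS w1 t1) _.
  rewrite (_ : (fun i => _) = (fun i => n i + if A i then u1 / f i else 0)) //.
  by apply/funext => i; rewrite mem_enum.
apply: le_trans (uH2 S D2 n TS w2 t2) _.
rewrite (_ : (fun i => _) = (fun i => n i + if A i then 0 else u2 / f i)) //.
by apply/funext => i; rewrite mem_enum /in_mem /=; case: (A i).
Qed.
End Node.

(** * Many subspaces of the same hardness *)

Section UniformNode.
Variables (R : realType).

(* A minorant of the mean of [`|y + X|], for [X] the sum of [m] independent fair
   signs, obtained from the second and fourth moments of [y + X]. *)
Definition walk_dist (t : R) (m : nat) (y : R) : R :=
  3 / (2 * t) * (y ^+ 2 + m%:R)
  - (y ^+ 4 + 6 * m%:R * y ^+ 2 + 3 * m%:R ^+ 2 - 2 * m%:R) / (2 * t ^+ 3).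

(** For [a = |y|], the polynomial stays below [a], with contact at 0 and tangency at [t]: the
    difference has the factor [a * (a - t) ^ 2]. *)
Lemma walk_dist0 t y : 0 < t -> walk_dist t 0 y <= `|y|.
Proof.
move=> t0; rewrite /walk_dist -(real_normK (num_real y)).
have -> : y ^+ 4 = `|y| ^+ 4 by rewrite -[4%N]/(2 * 2)%N !exprM real_normK ?num_real.
have y0 := normr_ge0 y; set a := `|y| in y0 *.
rewrite -subr_ge0.
have -> : a - (3 / (2 * t) * (a ^+ 2 + 0) -
    (a ^+ 4 + 6 * 0 * a ^+ 2 + 3 * 0 ^+ 2 - 2 * 0) / (2 * t ^+ 3)) =
    a * (a - t) ^+ 2 * (a + 2 * t) / (2 * t ^+ 3).
  by field; rewrite gt_eqF.
apply: divr_ge0; last by rewrite mulr_ge0 // exprn_ge0 // ltW.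
by apply: mulr_ge0; [rewrite mulr_ge0 ?sqr_ge0|lra].
Qed.

Lemma walk_distS t m y : t != 0 -> walk_dist t m.+1 y =
  (walk_dist t m (y + 1) + walk_dist t m (y - 1)) / 2.
Proof. by move=> t0; rewrite /walk_dist -natr1; field. Qed.

Variables (M : finType) (d : M -> M -> R).
Hypothesis d_refl : forall x, d x x = 0.
Hypothesis d_sym : forall x y, d x y = d y x.
Hypothesis d_tri : forall x y z, d x z <= d x y + d y z.
Variables (h : nat).
Notation I := {ffun 'I_h -> bool}.
Variables (B : I -> {set M}) (home : I -> M) (f Delta : R) (i0 : I).
Hypothesis Delta_gt0 : 0 < Delta.
Hypothesis f_ge1 : 1 <= f.
Hypothesis B_hard : forall i, hard d (B i) (home i) f (Delta / 2).
Hypothesis B_dist : forall i j x y,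
  i != j -> x \in B i -> y \in B j -> d x y = Delta.

Implicit Types (S : {set M}) (D : adversary R M) (n : I -> R) (t c v G nu : R).

Let T := \bigcup_i B i.
Let z := Delta / 2 / f.
Notation best := (best d i0 home).
Notation plays := (plays d B).

Let z_gt0 : 0 < z. Proof. by rewrite /z !divr_gt0 //; move: f_ge1; lra. Qed.

(* The adversary strikes [m] times, at random, the subspaces whose index has its
   [l]-th bit equal to 0, or those with bit 1; the offline player prefers the
   bit that was struck less often. *)
Lemma coordinate_phase t (l : 'I_h) D c v G m : 0 < t ->
    0 <= v -> v + m%:R * (Delta / 4) + Delta <= G -> plays D v G ->
    (forall S n (b : I) nu, T \subset S ->
       (forall x : I, (forall k : 'I_h, (l <= k)%N -> x k = b k) -> n x <= nu) ->
       expect D (best S n) <= nu + c) ->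
  exists2 D', plays D' (v + m%:R * (Delta / 4)) G &
    forall S n (b : I) nu0 nu1, T \subset S ->
      (forall x : I, (forall k : 'I_h, (l < k)%N -> x k = b k) ->
         n x <= if x l then nu1 else nu0) ->
      expect D' (best S n) <= (nu0 + nu1) / 2 + m%:R * z / 2
        - z / 2 * walk_dist t m ((nu1 - nu0) / z) + c.
Proof.
move=> t0 v0; elim: m => [|m IH] vG pD HD.
  exists D; first by rewrite mul0r addr0.
  (* No strike is left: the offline player settles for the bit with the smaller debt. *)
  move=> S n b nu0 nu1 TS Hn; pose nu := if nu1 <= nu0 then nu1 else nu0.
  pose b' : I := [ffun k => if k == l then nu1 <= nu0 else b k].
  apply: (@le_trans _ _ (nu + c)).
    apply: (HD S n b' nu TS) => x Hx; have := Hn x; have := Hx l (leqnn _).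
    rewrite ffunE eqxx => -> H; apply: H => k lk; rewrite Hx ?ffunE 1?ltnW //.
    by case: eqP lk => // ->; rewrite ltnn.
  rewrite lerD2r !mul0r addr0.
  (* The smaller of two debts is their mean minus half their distance, and [walk_dist t 0] minorizes
     this distance in units of [z]. *)
  have : z / 2 * walk_dist t 0 ((nu1 - nu0) / z) <= z / 2 * `|(nu1 - nu0) / z|.
    by rewrite ler_wpM2l ?walk_dist0 // divr_ge0 // ltW.
  rewrite normrM normfV (gtr0_norm z_gt0).
  have -> : z / 2 * (`|nu1 - nu0| / z) = `|nu1 - nu0| / 2.
    by field; rewrite gt_eqF.
  by rewrite /nu; case: (lerP nu1 nu0) => ?; lra.
have mS : m.+1%:R = m%:R + 1 :> R by rewrite natr1.
have D4 : 0 < Delta / 4 by rewrite divr_gt0.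
have vm : v + m%:R * (Delta / 4) + Delta <= G by move: vG; rewrite mS; lra.
have [Dm pm Hm] := IH vm pD HD.
have half : 0 <= 1 / 2 :> R by lra.
have vm0 : 0 <= v + m%:R * (Delta / 4) by rewrite addr_ge0 // mulr_ge0 // ltW.
(* A fair toss with strikes of [Delta / 2] on either side: debts grow by [z] on the struck half, so
   [(nu1 - nu0) / z] moves by 1 or -1. *)
have [||||D' pD' HD'] := @coin_step _ _ _ d_refl d_sym d_tri _ i0 _ _ _ _ Delta_gt0
   B_hard B_dist (fun x => x l) (1 / 2) (Delta / 2) (Delta / 2) Dm Dm _ _ G
   _ _ _ _ vm0 vm0 vm vm pm pm; try by [lra|move: Delta_gt0; lra].
exists D'.
  by move: pD'; congr plays; rewrite mS; field.
move=> S n b nu0 nu1 TS Hn; apply: le_trans (HD' S n TS) _.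
have H1 : expect Dm (best S (fun i => n i + if i l then z else 0)) <=
   (nu0 + (nu1 + z)) / 2 + m%:R * z / 2 - z / 2 * walk_dist t m ((nu1 - nu0) / z + 1) + c.
  rewrite (_ : (nu1 - nu0) / z + 1 = ((nu1 + z) - nu0) / z); last first.
    by field; rewrite gt_eqF.
  by apply: (Hm S _ b) => // x /Hn; case: (x l); rewrite ?addr0 ?lerD2r.
have H2 : expect Dm (best S (fun i => n i + if i l then 0 else z)) <=
   ((nu0 + z) + nu1) / 2 + m%:R * z / 2 - z / 2 * walk_dist t m ((nu1 - nu0) / z - 1) + c.
  rewrite (_ : (nu1 - nu0) / z - 1 = (nu1 - (nu0 + z)) / z); last first.
    by field; rewrite gt_eqF.
  by apply: (Hm S _ b) => // x /Hn; case: (x l); rewrite ?addr0 ?lerD2r.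
rewrite walk_distS ?gt_eqF // mS; move: H1 H2; rewrite -/z.
move: (expect _ _) (expect _ _) (walk_dist _ _ _) (walk_dist _ _ _) => a1 a2 w1 w2.
by lra.
Qed.

(** One phase per bit below [a], the highest first, each saving [z / 2 * walk_dist t N 0] on
    average. The bits from [a] on are already settled by the offline player, as given by [b]. *)
Lemma hypercube t N a G : 0 < t -> (a <= h)%N ->
  h%:R * (N%:R * (Delta / 4)) + Delta <= G ->
  exists2 D, plays D (a%:R * (N%:R * (Delta / 4))) G &
    forall S n (b : I) nu, T \subset S ->
       (forall x : I, (forall k : 'I_h, (a <= k)%N -> x k = b k) -> n x <= nu) ->
       expect D (best S n) <= nu + a%:R * (z / 2 * (N%:R - walk_dist t N 0)).
Proof.
move=> t0 + hG.
have D4 : 0 <= N%:R * (Delta / 4) by rewrite mulr_ge0 // divr_ge0 // ltW.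
elim: a => [_|a IH ah].
  exists Stop; first rewrite mul0r.
    apply: plays_stop; apply: le_trans hG; rewrite addr_ge0 ?mulr_ge0 //; exact: ltW.
  move=> S n b nu TS Hn; rewrite mul0r addr0.
  by apply: le_trans (best_stop d_refl i0 home S n b) _; apply: Hn.
have [D pD HD] := IH (ltnW ah).
have [||D' pD' HD'] := @coordinate_phase t (Ordinal ah) D _ _ G N t0 _ _ pD HD.
- by rewrite mulr_ge0.
- apply: le_trans hG; rewrite lerD2r -[X in _ + X <= _]mul1r -mulrDl natr1.
  by rewrite ler_wpM2r // ler_nat.
exists D'; first by move: pD'; congr plays; rewrite -natr1; ring.
move=> S n b nu TS Hn; apply: le_trans (HD' S n b nu nu TS _) _.
  by move=> x Hx; rewrite if_same; apply: Hn.
by rewrite subrr mul0r -(natr1 a); lra.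
Qed.

Lemma uniform_hard : (0 < h)%N ->
  hard d T (home i0) (f + h%:R / 432) ((432 * f ^+ 2 + h%:R + 1) * Delta).
Proof.
move=> h_gt0; have h0 : 1 <= h%:R :> R by rewrite ler1n.
have f2 : 1 <= f ^+ 2 by rewrite exprn_ege1.
have home_T i : home i \in B i by case: (B_hard i).
(* The savings must pay for the round trip [2 * Delta] and still improve the ratio, while the total
   stake stays bounded in terms of [f ^ 2] and [h]. *)
suff [t [N [t0 N0 NG Nw]]] : exists t : R, exists N : nat, [/\ 0 < t, (0 < N)%N,
    h%:R * N%:R / 4 <= 432 * f ^+ 2 + h%:R &
    2 * Delta + h%:R * (z / 2 * (N%:R - walk_dist t N 0)) <=
      h%:R * (N%:R * (Delta / 4)) / (f + h%:R / 432)].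
  have N1 : 1 <= N%:R :> R by rewrite ler1n.
  have [|D [wD tD lD] HD] := @hypercube t N h ((432 * f ^+ 2 + h%:R + 1) * Delta) t0 (leqnn _).
    rewrite mulrDl mul1r lerD2r mulrA.
    rewrite (_ : _ * (Delta / 4) = (h%:R * N%:R / 4) * Delta); last by field.
    by rewrite ler_wpM2r // ltW.
  apply: (@hard_of_extorts _ _ _ d_refl d_tri _ _ _ _ _ D _ _ _ _ wD tD lD).
  - by apply/finset.bigcupP; exists i0.
  - by rewrite !mulr_gt0 ?divr_gt0 ?ltr0n.
  - by move: f_ge1; lra.
  - by apply: mulr_ge0; [lra|exact: (ltW Delta_gt0)].
  - move=> S TS; apply: le_trans Nw.
    apply: (@le_trans _ _
      (expect D (best S (fun j => if j == i0 then 0 else 2 * Delta)))).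
      apply: (le_expect wD tD) => s _.
      exact: (@offline_best _ _ _ d_sym d_tri _ _ _ _ _ _ B_hard B_dist).
    apply: (HD S _ i0) => // x _; case: eqP => _ //.
    by move: Delta_gt0; lra.
have f0 : 0 < f by move: f_ge1; lra.
have [hf|hf] := lerP h%:R (12 * f).
  (* the smallest [j] for which the mean saving [h * z * j / 2] exceeds
     [3 * Delta]: moving there and back, plus a gain of [Delta] *)
  pose j := (Num.truncn (12 * f / h%:R)).+1.
  have q1 : 1 <= 12 * f / h%:R by rewrite ler_pdivlMr ?mul1r // ltr0n.
  have /andP[j1 j2] := truncn_itv (le_trans ler01 q1).
  have jlo : 12 * f <= h%:R * j%:R.
    by move/ltW: j2; rewrite ler_pdivrMr ?ltr0n // -/j; lra.
  have jhi : h%:R * j%:R <= 24 * f.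
    have : j%:R <= 24 * f / h%:R by rewrite /j -natr1; lra.
    by rewrite ler_pdivlMr ?ltr0n //; lra.
  have j0 : 1 <= j%:R :> R by rewrite ler1n.
  (* With this [N], [t = 3 * j] is the square root of [3 * N], which maximizes the leading part of
     [walk_dist t N 0]; the value is then slightly above [j]. *)
  pose N := (3 * j ^ 2)%N; have NE : N%:R = 3 * j%:R ^+ 2 :> R by rewrite natrM natrX.
  exists (3 * j%:R), N; split; first lra.
  - by rewrite muln_gt0 expn_gt0.
  - rewrite NE.
    have hj : h%:R * j%:R ^+ 2 <= 576 * f ^+ 2.
      have : (h%:R * j%:R) ^+ 2 <= (24 * f) ^+ 2 by rewrite lerXn2r ?nnegrE //; nra.
      have : h%:R * j%:R ^+ 2 <= (h%:R * j%:R) ^+ 2 :> R.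
        rewrite [X in _ <= X](_ : _ = h%:R * j%:R ^+ 2 * h%:R); last by ring.
        by rewrite ler_peMr // mulr_ge0 ?sqr_ge0.
      by nra.
    by lra.
  - have wj : j%:R <= walk_dist (3 * j%:R) N 0.
      rewrite /walk_dist NE.
      have -> : 3 / (2 * (3 * j%:R)) * (0 ^+ 2 + 3 * j%:R ^+ 2) -
         (0 ^+ 4 + 6 * (3 * j%:R ^+ 2) * 0 ^+ 2 + 3 * (3 * j%:R ^+ 2) ^+ 2 -
          2 * (3 * j%:R ^+ 2)) / (2 * (3 * j%:R) ^+ 3) = j%:R + (9 * j%:R)^-1 :> R.
        by field; rewrite gt_eqF //; lra.
      by rewrite lerDl invr_ge0; lra.
    pose g := 3 * h%:R * j%:R ^+ 2 / 4 :> R; pose gam := h%:R / 432 : R.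
    (* Since [h * j <= 24 * f], [g * gam = (h * j) ^ 2 / 576 <= f ^ 2]; this is where 432 comes
       from. *)
    have g_gam : g * gam / f <= f.
      by rewrite ler_pdivrMr // /g /gam; nra.
    have gf : g / f - 1 <= g / (f + gam).
      have gam0 : 0 < gam by rewrite /gam; lra.
      rewrite ler_pdivlMr; last by lra.
      rewrite [X in X <= _](_ : _ = g + g * gam / f - f - gam); last by field; rewrite gt_eqF.
      by lra.
    have saving : 3 * Delta <= h%:R * (z / 2 * walk_dist (3 * j%:R) N 0).
      have : h%:R * (z / 2 * j%:R) <= h%:R * (z / 2 * walk_dist (3 * j%:R) N 0).
        by rewrite !ler_wpM2l ?divr_ge0 // ltW.
      apply: le_trans; rewrite /z.
      have -> : h%:R * (Delta / 2 / f / 2 * j%:R) = (h%:R * j%:R) * Delta / 4 / f.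
        by field; rewrite gt_eqF.
      by rewrite ler_pdivlMr //; have := ler_wpM2r (ltW Delta_gt0) jlo; lra.
    have -> : h%:R * (N%:R * (Delta / 4)) / (f + h%:R / 432) =
       Delta * (g / (f + gam)).
      by rewrite NE /g /gam; field; apply: lt0r_neq0; lra.
    have : Delta * (g / f - 1) <= Delta * (g / (f + gam)) by rewrite ler_wpM2l // ltW.
    apply: le_trans.
    have -> : h%:R * (z / 2 * (N%:R - walk_dist (3 * j%:R) N 0)) =
       Delta * (g / f) - h%:R * (z / 2 * walk_dist (3 * j%:R) N 0).
      by rewrite NE /g /z; field; rewrite gt_eqF.
    by lra.
(* With so many bits, one strike per bit is enough: the offline player avoids them all and pays only
   the round trip. *)
exists 1, 1%N; split=> //; first by rewrite mulr1; lra.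
have -> : walk_dist 1 1 0 = 1 :> R by rewrite /walk_dist; field.
rewrite subrr !mulr0 addr0 ler_pdivlMr; last by lra.
have D1 := ltW Delta_gt0; have hf' : 0 <= h%:R / 12 - f by lra.
have := mulr_ge0 D1 hf'; have : 0 <= Delta * h%:R by rewrite mulr_ge0.
by lra.
Qed.
End UniformNode.

(** * Two subspaces of different hardness *)

Lemma ln2_le1 (R : realType) : ln 2 <= 1 :> R.
Proof. by have := @le_ln1Dx R 1; rewrite (_ : 1 + 1 = 2) //; apply; lra. Qed.

Lemma ln2_ge_half (R : realType) : 1 / 2 <= ln 2 :> R.
Proof.
have := @le_ln1Dx R (- (1 / 2)); rewrite (_ : 1 + _ = 2^-1); last by field.
by rewrite lnV ?posrE // => /(_ _)/wrap[|H2]; lra.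
Qed.

(** * Gambler's ruin with a finite horizon *)

Section Ruin.
Variables (R : realType) (p rho : R) (L : nat).
Hypothesis p_gt0 : 0 < p.
Hypothesis rho_ge1 : 1 <= rho.
Hypothesis p_rho : p + rho * p = 1.
Implicit Types (n Z : nat).

(* The walk steps up with probability [p] and down with probability [rho * p],
   until it reaches [0] or [L], or until time [n]; [duration] is the mean
   number of steps, [win] and [survive] are the probabilities to have reached
   [L] and to be still walking. *)
Fixpoint duration n Z : R :=
  if n is n'.+1 then
    if (Z == 0)%N || (Z == L) then 0
    else 1 + p * duration n' Z.+1 + rho * p * duration n' Z.-1
  else 0.

Fixpoint win n Z : R :=
  if (Z == L)%N then 1 else
  if n is n'.+1 then
    if (Z == 0)%N then 0 else p * win n' Z.+1 + rho * p * win n' Z.-1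
  else 0.

Fixpoint survive n Z : R :=
  if (Z == 0)%N || (Z == L) then 0 else
  if n is n'.+1 then p * survive n' Z.+1 + rho * p * survive n' Z.-1 else 1.

Let q_gt0 : 0 < rho * p.
Proof. by rewrite mulr_gt0 // (lt_le_trans ltr01). Qed.

Lemma walk_interior (P : nat -> Prop) :
  (forall Z, (Z <= L)%N -> P Z) ->
  forall Z, (Z <= L)%N -> (Z == 0)%N || (Z == L) = false ->
  P Z.+1 /\ P Z.-1.
Proof.
move=> H Z ZL /negbT; rewrite negb_or => /andP[Z0 ZnL].
by split; apply: H; [rewrite ltn_neqAle ZnL|apply: leq_trans ZL; apply: leq_pred].
Qed.

Lemma duration_ge0 n Z : 0 <= duration n Z.
Proof.
elim: n Z => //= n IH Z; case: ifP => // _.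
by rewrite !addr_ge0 // mulr_ge0 // ltW.
Qed.

(** [Z * (2 * L - Z)] decreases by 1 on average under a fair step. It is increasing up to [L], so
    the downward drift can only make it decrease faster. *)
Lemma duration_le n Z : (Z <= L)%N ->
  duration n Z <= Z%:R * (2 * L%:R - Z%:R).
Proof.
elim: n Z => [|n IH] Z ZL /=.
  have : Z%:R <= L%:R :> R by rewrite ler_nat.
  by have : 0 <= Z%:R :> R by []; nra.
have ZLR : Z%:R <= L%:R :> R by rewrite ler_nat.
have Z0R : 0 <= Z%:R :> R by [].
case: ifP => [_|inn]; first by nra.
have [H1 H2] := walk_interior IH ZL inn.
case: Z ZL inn H1 H2 ZLR Z0R => // Z ZL _ H1 H2 ZLR _ /=.
move: H1 H2 ZLR; rewrite /= -!natr1 => H1 H2 ZLR.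
set z := Z%:R in H1 H2 ZLR *; set l := L%:R in H1 H2 ZLR *.
have K1 := ler_wpM2l (ltW p_gt0) H1; have K2 := ler_wpM2l (ltW q_gt0) H2.
apply: (@le_trans _ _ (1 + p * ((z + 1 + 1) * (2 * l - (z + 1 + 1))) +
  rho * p * (z * (2 * l - z)))); first by lra.
have qE : rho * p = 1 - p by rewrite -p_rho; ring.
have p2 : p * 2 <= 1 by have := ler_wpM2r (ltW p_gt0) rho_ge1; rewrite qE; lra.
rewrite qE.
have : 0 <= (1 - p * 2) * (l - (z + 1)).
  by apply: mulr_ge0; lra.
by lra.
Qed.

Lemma survive_le1 n Z : survive n Z <= 1.
Proof.
elim: n Z => [|n IH] Z /=; case: ifP => // _.
have := ler_wpM2l (ltW p_gt0) (IH Z.+1); have := ler_wpM2l (ltW q_gt0) (IH Z.-1).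
by move: p_rho; lra.
Qed.

(** Markov's inequality: a walk still alive at time [n] has made [n] steps. *)
Lemma survive_le_duration n Z : n%:R * survive n Z <= duration n Z.
Proof.
elim: n Z => [|n IH] Z /=; first by rewrite mul0r.
case: ifP => inn; first by rewrite mulr0.
have := survive_le1 n.+1 Z; rewrite /= inn => s1.
have := ler_wpM2l (ltW p_gt0) (IH Z.+1); have := ler_wpM2l (ltW q_gt0) (IH Z.-1).
by rewrite -natr1; lra.
Qed.

(** Scale function of the walk: [sm Z / sm L] is harmonic, and is the probability to reach [L]
    before 0 with unlimited time. *)
Let sm Z : R := \sum_(i < Z) rho ^+ i.

Let sm_le Z : (Z <= L)%N -> sm Z <= sm L.
Proof.
move=> ZL; rewrite /sm -(subnKC ZL) big_split_ord /= lerDl sumr_ge0 // => i _.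
by rewrite exprn_ge0 // (le_trans ler01).
Qed.

(** Stopping at time [n] loses at most the walks that are still alive. *)
Lemma win_ge n Z : (Z <= L)%N -> (0 < L)%N ->
  sm Z / sm L - survive n Z <= win n Z.
Proof.
move=> + L0; have smL : 0 < sm L.
  rewrite /sm; case: (L) L0 => // l _; rewrite big_ord_recl expr0 ltr_pwDl //.
  by rewrite sumr_ge0 // => i _; rewrite exprn_ge0 // (le_trans ler01).
elim: n Z => [|n IH] Z ZL /=.
  have [->|ZnL] := eqVneq Z L; first by rewrite orbT divff ?subr0 // gt_eqF.
  have [->|Z0] := eqVneq Z 0%N; first by rewrite /sm big_ord0 mul0r subr0.
  by rewrite /= subr_le0 ler_pdivrMr // mul1r sm_le.
have [->|ZnL] := eqVneq Z L; first by rewrite orbT divff ?subr0 // gt_eqF.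
have [->|Z0] := eqVneq Z 0%N; first by rewrite /sm big_ord0 mul0r subr0.
have inn : (Z == 0)%N || (Z == L) = false by rewrite (negbTE Z0) (negbTE ZnL).
have [H1 H2] := walk_interior IH ZL inn.
have K1 := ler_wpM2l (ltW p_gt0) H1; have K2 := ler_wpM2l (ltW q_gt0) H2.
have -> : sm Z / sm L = p * (sm Z.+1 / sm L) + rho * p * (sm Z.-1 / sm L).
  case: Z {ZL H1 H2 K1 K2 ZnL inn} Z0 => // Z _.
  rewrite /sm !big_ord_recr /= exprS; set a := \sum_(i < Z) _.
  rewrite !mulrA -mulrDl; congr (_ / _).
  rewrite -{1}[a + _]mul1r -p_rho; ring.
by rewrite /=; lra.
Qed.

Lemma ruin : (1 < L)%N -> exists2 N, (0 < N)%N & (2 * L%:R * rho ^+ L)^-1 <= win N 1.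
Proof.
move=> L1; have L0 : (0 < L)%N by apply: ltnW.
have rL : 0 < rho ^+ L by rewrite exprn_gt0 // (lt_le_trans ltr01).
have LR : 1 <= L%:R :> R by rewrite ler1n.
pose w := (2 * L%:R * rho ^+ L)^-1.
have w0 : 0 < w by rewrite invr_gt0 !mulr_gt0 // ltr0n.
(* So large that [survive N 1 <= w], half of the lower bound [2 * w] on [sm 1 / sm L]. *)
pose N := (Num.truncn (2 * L%:R / w)).+1; exists N => //.
have NL : 2 * L%:R <= N%:R * w.
  by rewrite -ler_pdivrMr //; apply/ltW/truncnS_gt.
have N0 : 0 < N%:R :> R by rewrite ltr0n.
have surv : survive N 1 <= w.
  rewrite -(ler_pM2l N0); apply: le_trans (survive_le_duration N 1) _.
  apply: le_trans (duration_le N L0) _; rewrite mul1r.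
  by apply: le_trans NL; lra.
have sm1 : sm 1 / sm L >= 2 * w.
  rewrite /sm big_ord_recl big_ord0 addr0 expr0 mul1r.
  have -> : 2 * w = (L%:R * rho ^+ L)^-1.
    by rewrite /w; field; rewrite !gt_eqF // ltr0n.
  rewrite lef_pV2 ?posrE ?mulr_gt0 ?ltr0n //.
    apply: (@le_trans _ _ (\sum_(i < L) rho ^+ L)).
      by apply: ler_sum => i _; rewrite ler_weXn2l // ltnW.
    by rewrite sumr_const card_ord mulr_natl.
  rewrite /sm; case: (L) L0 => // l _; rewrite big_ord_recl expr0 ltr_pwDl //.
  by rewrite sumr_ge0 // => i _; rewrite exprn_ge0 // (le_trans ler01).
have := win_ge N L0 L0; rewrite -/w; lra.
Qed.

End Ruin.

(** * Ruin and streak adversaries on two subspaces *)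

Section TwoSubspaces.
Variables (R : realType) (M : finType) (d : M -> M -> R).
Hypothesis d_refl : forall x, d x x = 0.
Hypothesis d_sym : forall x y, d x y = d y x.
Hypothesis d_tri : forall x y z, d x z <= d x y + d y z.
Variables (B : bool -> {set M}) (home : bool -> M) (f : bool -> R) (Delta : R).
Hypothesis Delta_gt0 : 0 < Delta.
Hypothesis f_ge1 : 1 <= f false.
Hypothesis f_le : f false <= f true.
Hypothesis B_hard : forall i, hard d (B i) (home i) (f i) (Delta / 2).
Hypothesis B_dist : forall i j x y,
  i != j -> x \in B i -> y \in B j -> d x y = Delta.
Implicit Types (S : {set M}) (D : adversary R M) (n : bool -> R).

Let T := \bigcup_i B i.
Let z := Delta / 2 / f true.
Notation best := (best d true home).
Notation plays := (plays d B).

Let ft_ge1 : 1 <= f true. Proof. exact: le_trans f_le. Qed.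
Let ft_gt0 : 0 < f true. Proof. exact: lt_le_trans ft_ge1. Qed.
Let ff_gt0 : 0 < f false. Proof. exact: lt_le_trans f_ge1. Qed.
Let z_gt0 : 0 < z. Proof. by rewrite /z !divr_gt0. Qed.
Let zE : z * f true = Delta / 2. Proof. by rewrite /z; field; rewrite gt_eqF. Qed.

(** The debt [2 * Delta] on [false] pays the round trip from [home true]. Raising the ratio by [gam]
    requires lowering the offline cost by [g * gam / (f true * (f true + gam))], which the saving
    [b * Delta] covers. *)
Lemma hard_of_saving D g G b gam : plays D g G -> 0 < g -> 0 <= G -> 0 < gam ->
  g * gam <= b * Delta * f true ^+ 2 ->
  (forall S n, T \subset S -> n true = 0 -> n false = 2 * Delta ->
     expect D (best S n) <= g / f true - b * Delta) ->
  hard d T (home true) (f true + gam) G.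
Proof.
move=> [wD tD lD] g0 G0 gam0 gain HD.
apply: (@hard_of_extorts _ _ _ d_refl d_tri _ _ _ _ _ D _ _ _ _ wD tD lD) => //.
- by apply/finset.bigcupP; exists true => //; case: (B_hard true).
- by rewrite addr_gt0.
move=> S TS; apply: (@le_trans _ _
  (expect D (best S (fun j => if j == true then 0 else 2 * Delta)))).
  apply: (le_expect wD tD) => s _.
  exact: (@offline_best _ _ _ d_sym d_tri _ _ _ _ _ _ B_hard B_dist).
apply: le_trans (HD S _ TS _ _) _ => //.
have fg : 0 < f true + gam by rewrite addr_gt0.
rewrite lerBlDr -lerBlDl.
have -> : g / f true - g / (f true + gam) = g * gam / (f true * (f true + gam)).
  by field; rewrite !gt_eqF.
have bD : 0 <= b * Delta.
  have : 0 <= b * Delta * f true ^+ 2 by apply: le_trans gain; rewrite mulr_ge0 // ltW.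
  by rewrite pmulr_lge0 // exprn_gt0.
rewrite ler_pdivrMr ?mulr_gt0 //; apply: le_trans gain _.
apply: ler_wpM2l => //; rewrite expr2.
by apply: ler_wpM2l; [exact: ltW|rewrite lerDl ltW].
Qed.

(* Each strike costs an offline player [z], in either subspace. The difference
   between the strikes on [true] and on [false] is a walk as above, and the
   offline player serves everything in [false] when it ends at [L]. *)
Lemma ruin_play L p G : 0 < p <= 1 / 2 -> p * f true = (1 - p) * f false ->
  Delta / 4 * L%:R ^+ 2 + Delta <= G ->
  let rho := f true / f false in
  forall N Z, (Z <= L)%N -> exists2 D,
    plays D (p * (Delta / 2) * duration p rho L N Z) G &
    forall S n c, T \subset S -> n false <= n true - z * Z%:R + c ->
      expect D (best S n) <= n true + p * z * duration p rho L N Z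
        - win p rho L N Z * (z * L%:R - c).
Proof.
move=> /andP[p0 p_half] bal GL rho.
have rhop : rho * p = 1 - p.
  have : rho * p * f false = (1 - p) * f false by rewrite -bal /rho; field; rewrite gt_eqF.
  by apply: mulIf; rewrite gt_eqF.
have rho1 : 1 <= rho by rewrite ler_pdivlMr ?mul1r.
have p_rho : p + rho * p = 1 by rewrite rhop; ring.
have G0 : 0 <= G.
  by apply: le_trans GL; rewrite addr_ge0 ?mulr_ge0 ?divr_ge0 ?exprn_ge0 // ltW.
(* The game is over, by absorption or for lack of time: the offline player uses [false] if [Z = L],
   and [true] otherwise. *)
have stop N Z : (Z <= L)%N -> duration p rho L N Z = 0 ->
    (Z != L -> win p rho L N Z = 0) -> (Z = L -> win p rho L N Z = 1) ->
  exists2 D, plays D (p * (Delta / 2) * duration p rho L N Z) G &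
    forall S n c, T \subset S -> n false <= n true - z * Z%:R + c ->
      expect D (best S n) <= n true + p * z * duration p rho L N Z
        - win p rho L N Z * (z * L%:R - c).
  move=> ZL -> w0 w1; exists Stop; first by rewrite mulr0; apply: plays_stop.
  move=> S n c TS Hn; have [ZE|ZnL] := eqVneq Z L.
    apply: le_trans (best_stop d_refl true home S n false) _.
    by rewrite w1 // -ZE; lra.
  apply: le_trans (best_stop d_refl true home S n true) _.
  by rewrite w0 //; lra.
elim=> [|N IH] Z ZL.
  by apply: stop => //= [/negbTE->|->] //; rewrite eqxx.
have [inn|inn] := boolP ((Z == 0)%N || (Z == L)).
  apply: stop => //=; first by rewrite inn.
    by move=> /negbTE ZnL; move: inn; rewrite ZnL orbF => ->.
  by move=> ->; rewrite eqxx.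
have [[D1 pD1 HD1] [D2 pD2 HD2]] := walk_interior IH ZL (negbTE inn).
have dur0 Y : 0 <= duration p rho L N Y by apply: duration_ge0.
have val0 Y : 0 <= p * (Delta / 2) * duration p rho L N Y.
  by rewrite !mulr_ge0 // ltW // divr_gt0.
have [ZL1 ZL2] := walk_interior (P := fun Y => (Y <= L)%N) (fun _ => id) ZL (negbTE inn).
(* As [p <= 1 / 2] and the mean duration is at most [L ^ 2], the remaining stake is at most
   [Delta / 4 * L ^ 2]. *)
have valG Y : (Y <= L)%N -> p * (Delta / 2) * duration p rho L N Y + Delta <= G.
  move=> YL; apply: le_trans GL; rewrite lerD2r.
  have YLR : Y%:R <= L%:R :> R by rewrite ler_nat.
  have H := duration_le p0 rho1 p_rho N YL.
  apply: ler_pM => //.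
  - by rewrite mulr_ge0 // ltW // divr_gt0.
  - by have := ler_wpM2r (ltW Delta_gt0) p_half; lra.
  - by apply: le_trans H _; have := sqr_ge0 (L%:R - Y%:R : R); lra.
(* A strike of [z * f false] on [false] costs the offline player [z], just as one of [Delta / 2] on
   [true]; [bal] then balances the online losses. *)
have u2 : 0 <= z * f false <= Delta / 2.
  apply/andP; split; first by apply: mulr_ge0; apply: ltW.
  by rewrite -zE; apply: ler_wpM2l => //; apply: ltW.
have p01 : 0 <= p <= 1 by rewrite ltW //=; lra.
have u1 : 0 <= Delta / 2 <= Delta / 2 by rewrite lexx andbT; have := Delta_gt0; lra.
have u12 : p * (Delta / 2) = (1 - p) * (z * f false) by rewrite -zE mulrCA bal; ring.
have [D pD HD] := @coin_step _ _ _ d_refl d_sym d_tri _ true _ _ _ _ Delta_gt0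
   B_hard B_dist (fun i => i) p (Delta / 2) (z * f false) D1 D2 _ _ G
   p01 u1 u2 u12 (val0 _) (val0 _) (valG _ ZL1) (valG _ ZL2) pD1 pD2.
exists D.
  move: pD; congr plays; rewrite /= (negbTE inn) rhop; ring.
move: inn; rewrite negb_or => /andP[Z0 ZnL].
move=> S n c TS Hn; apply: le_trans (HD S n TS) _.
rewrite /= (negbTE Z0) (negbTE ZnL) rhop /=.
have := HD1 S (fun i => n i + if i then Delta / 2 / f i else 0) c TS.
have := HD2 S (fun i => n i + if i then 0 else z * f false / f i) c TS.
rewrite /= -/z mulfK ?gt_eqF // !addr0.
have ZS : Z%:R = Z.-1%:R + 1 :> R by rewrite natr1 prednK // lt0n.
move=> /(_ _)/wrap[|K2]; first by move: Hn; rewrite ZS; lra.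
move=> /(_ _)/wrap[|K1]; first by move: Hn; rewrite -natr1; lra.
have := ler_wpM2l (ltW p0) K1.
have := ler_wpM2l (_ : 0 <= 1 - p) K2.
move=> /(_ _)/wrap[|]; first by lra.
move: (expect _ _) (expect _ _) (duration _ _ _ _ _) (duration _ _ _ _ _).
move: (win _ _ _ _ _) (win _ _ _ _ _) => *.
by lra.
Qed.

(* When [f false] is much smaller than [f true], gambler's ruin is too unlikely;
   instead the adversary stops as soon as it strikes [false]. *)
Lemma streak_play G N : 3 / 2 * Delta <= G ->
  exists dur : R, 1 - (N == 0)%:R <= dur <= 2 /\ exists2 D,
    plays D (Delta / 4 * dur) G &
    forall S n c, T \subset S -> n false <= n true + z * N%:R - c ->
      expect D (best S n) <= n true + z / 2 * dur - 2^-1 ^+ N * c.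
Proof.
move=> hG; have D0 := ltW Delta_gt0; elim: N => [|N [dur [/andP[dur0 dur2] [D pD HD]]]].
  exists 0; split; first by rewrite eqxx subrr lexx /=; lra.
  exists Stop; first by rewrite mulr0; apply: plays_stop; lra.
  move=> S n c TS Hn; apply: le_trans (best_stop d_refl true home S n false) _.
  by rewrite expr0; lra.
have dur_ge0 : 0 <= dur by apply: le_trans dur0; case: eqP => _ /=; lra.
(* [dur] is the mean number of strikes: one now, and the others with probability 1/2. It never
   exceeds the fixed point 2. *)
exists (1 + dur / 2); split; first by rewrite subr0; apply/andP; split; lra.
have v0 : 0 <= Delta / 4 * dur by rewrite mulr_ge0 // divr_ge0.
have vG : Delta / 4 * dur + Delta <= G.
  have : Delta / 4 * dur <= Delta / 4 * 2 by rewrite ler_wpM2l // divr_ge0.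
  by lra.
have G0 : 0 + Delta <= G by lra.
have half : 0 <= (1 / 2 : R) <= 1 by apply/andP; split; lra.
have u1 : 0 <= Delta / 2 <= Delta / 2 by rewrite lexx andbT; lra.
have u12 : 1 / 2 * (Delta / 2) = (1 - 1 / 2) * (Delta / 2) by field.
have pS : plays Stop 0 G by apply: plays_stop; lra.
have [E pE HE] := @coin_step _ _ _ d_refl d_sym d_tri _ true _ _ _ _ Delta_gt0
   B_hard B_dist (fun i => i) (1 / 2) _ _ D Stop _ _ G
   half u1 u1 u12 v0 (lexx 0) vG G0 pD pS.
exists E; first by move: pE; congr plays; field.
move=> S n c TS Hn; apply: le_trans (HE S n TS) _.
have K2 := best_stop d_refl true home S (fun i => n i + if i then 0 else Delta / 2 / f i) true.
have := HD S (fun i => n i + if i then Delta / 2 / f i else 0) c TS.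
rewrite /= addr0 -/z => /(_ _)/wrap[|K1]; first by move: Hn; rewrite -natr1; lra.
move: K2; rewrite /= addr0 exprS; set b := best S _ [::] => K2.
by lra.
Qed.

(** With [F = f true], the adversary bets on an excess of about [6 * F] strikes on [true]. They cost
    [6 * F * z = 3 * Delta] there, which pays the round trip and leaves a saving of [Delta]. Streaks
    are used when [F > 2 * f false], the ruin otherwise. *)
Lemma two_subspaces_hard : hard d T (home true)
  (f true + expR (- 16 * (f true - f false)) / 64) ((16 * f true ^+ 2 + 1) * Delta).
Proof.
set F := f true; set F' := f false; have D0 := ltW Delta_gt0.
have FF' : F' <= F by [].
have F1 : 1 <= F by []. have F'1 : 1 <= F' by [].
have F2 : 1 <= F ^+ 2 by rewrite exprn_ege1.
have G0 : 0 <= (16 * F ^+ 2 + 1) * Delta by rewrite mulr_ge0 //; lra.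
have gam0 : 0 < expR (- 16 * (F - F')) / 64 by rewrite divr_gt0 ?expR_gt0.
have z_le : z * F = Delta / 2 by apply: zE.
have F6 : 0 <= 6 * F by lra.
have /andP[tr1 tr2] := truncn_itv F6.
have [F'F|F'F] := lerP F (2 * F'); last first.
- pose L := (Num.truncn (6 * F)).+1.
  have Llo : 6 * F <= L%:R by apply: ltW.
  have Lhi : L%:R <= 7 * F by rewrite /L -natr1; lra.
  have GD : 3 / 2 * Delta <= (16 * F ^+ 2 + 1) * Delta by rewrite ler_wpM2r //; lra.
  have [dur [/andP[dur1 dur2] [D pD HD]]] := streak_play L GD.
  move: dur1; rewrite subr0 => dur1.
  apply: (hard_of_saving (b := 2^-1 ^+ L) pD) => //.
  + by rewrite mulr_gt0 ?divr_gt0 //; lra.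
  (* Here [F - F' > F / 2], so [16 * (F - F')] exceeds [8 * F], while [L * ln 2 <= 7 * F]. *)
  + have e1 : expR (- 16 * (F - F')) <= 2^-1 ^+ L.
      have -> : 2^-1 = expR (- ln 2) :> R by rewrite expRN lnK // posrE.
      rewrite -expRM_natr ler_expR.
      have := ln2_le1 R.
      have : 0 <= ln 2 :> R by rewrite ln_ge0 //; lra.
      have : 0 <= L%:R :> R by [].
      by nra.
    have w0 : 0 <= 2^-1 ^+ L :> R by rewrite exprn_ge0.
    have d2 : Delta / 4 * dur <= Delta by have := ler_wpM2l D0 dur2; lra.
    apply: (@le_trans _ _ (Delta * 2^-1 ^+ L)).
      have A : 0 <= Delta / 4 * dur by apply: mulr_ge0; lra.
      apply: (ler_pM A (ltW gam0) d2).
      by apply: le_trans e1; have := expR_gt0 (- 16 * (F - F')); lra.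
    by rewrite mulrC ler_peMr // mulr_ge0.
  + move=> S n TS n0 n1; apply: le_trans (HD S n Delta TS _) _.
      rewrite n0 n1.
      have : z * (6 * F) <= z * L%:R by rewrite ler_wpM2l // ltW.
      by have := z_le; lra.
    rewrite n0 /z -/F lerD2r add0r le_eqVlt; apply/orP; left; apply/eqP.
    by field; rewrite gt_eqF.
(* One unit more than for streaks, because the walk starts at 1. *)
pose L := (Num.truncn (6 * F)).+2.
have LE : L%:R = (Num.truncn (6 * F)).+1%:R + 1 :> R by rewrite natr1.
have Llo : 6 * F <= L%:R - 1 by rewrite LE addrK; apply: ltW.
have Lhi : L%:R <= 8 * F by rewrite LE -(natr1 (Num.truncn (6 * F))); lra.
pose p := F' / (F + F').
have FF0 : 0 < F + F' by lra.
have p0 : 0 < p <= 1 / 2.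
  rewrite /p divr_gt0 //=; first by rewrite ler_pdivrMr //; lra.
have bal : p * F = (1 - p) * F' by rewrite /p; field; rewrite gt_eqF.
have GL : Delta / 4 * L%:R ^+ 2 + Delta <= (16 * F ^+ 2 + 1) * Delta.
  have : L%:R ^+ 2 <= (8 * F) ^+ 2 by rewrite lerXn2r ?nnegrE //; lra.
  by move=> H; have := ler_wpM2l D0 H; rewrite exprMn; lra.
pose rho := F / F'.
have rho1 : 1 <= rho by rewrite ler_pdivlMr ?mul1r.
have p_rho : p + rho * p = 1 by rewrite /p /rho; field; rewrite !gt_eqF.
have /andP[p00 p_half] := p0.
have [N N0 wN] := @ruin _ p rho L p00 rho1 p_rho isT.
have [D pD HD] := @ruin_play L p _ p0 bal GL N 1 isT.
set dur := duration p rho L N 1 in pD HD.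
have dur1 : 1 <= dur.
  have L1 : (1 == L)%N = false by [].
  have dur0 N' Z := duration_ge0 L p00 rho1 N' Z.
  rewrite /dur; case: (N) N0 => // N' _; rewrite /= ?L1 /= -addrA lerDl.
  have rho_p : 0 <= rho * p by apply: mulr_ge0; [lra|exact: (ltW p00)].
  by apply: addr_ge0; apply: mulr_ge0 => //; exact: (ltW p00).
have dur2 : dur <= 2 * L%:R.
  by apply: le_trans (duration_le p00 rho1 p_rho N (isT : (1 <= L)%N)) _; lra.
(* From [rho <= exp (rho - 1)] and [(rho - 1) * L = (F - F') * L / F'], where
   [L <= 8 * F <= 16 * F']. *)
have rhoL : rho ^+ L <= expR (16 * (F - F')).
  apply: (@le_trans _ _ (expR (rho - 1) ^+ L)).
    rewrite lerXn2r ?nnegrE ?expR_ge0 //; first by lra.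
    by have := expR_ge1Dx (rho - 1); lra.
  rewrite -expRM_natr ler_expR.
  have -> : rho - 1 = (F - F') / F' by rewrite /rho; field; rewrite gt_eqF.
  rewrite mulrAC ler_pdivrMr //.
  have : (F - F') * L%:R <= (F - F') * (16 * F') by apply: ler_wpM2l; lra.
  by lra.
have L0 : 0 < L%:R :> R by rewrite ltr0n.
have rho0 : 0 < rho ^+ L by rewrite exprn_gt0 // (lt_le_trans ltr01).
have w0 : 0 < win p rho L N 1.
  by apply: (lt_le_trans _ wN); rewrite invr_gt0; apply: mulr_gt0 => //; apply: mulr_gt0.
apply: (hard_of_saving (b := win p rho L N 1) pD) => //.
- apply: mulr_gt0; last exact: (lt_le_trans ltr01 dur1).
  by apply: mulr_gt0 => //; apply: divr_gt0.
- have g_le : p * (Delta / 2) * dur <= Delta / 2 * L%:R.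
    have : p * (Delta / 2) <= Delta / 4 by have := ler_wpM2r D0 p_half; lra.
    move=> H; apply: (@le_trans _ _ (Delta / 4 * (2 * L%:R))); last by lra.
    have A : 0 <= p * (Delta / 2) by apply: mulr_ge0; [exact: (ltW p00)|lra].
    exact: (ler_pM A (le_trans ler01 dur1) H dur2).
  set e := expR (- 16 * (F - F')) / 64 in gam0 *.
  have e_rho : e * rho ^+ L <= 1 / 64.
    have -> : 1 / 64 = e * expR (16 * (F - F')).
      by rewrite /e mulrAC -expRD mulNr addNr expR0.
    by rewrite ler_wpM2l // ltW.
  apply: (@le_trans _ _ (Delta / 2 * L%:R * e)).
    by rewrite ler_wpM2r // ltW.
  apply: (@le_trans _ _ (Delta * F ^+ 2 / (2 * L%:R * rho ^+ L))); last first.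
    rewrite [X in _ <= X](_ : _ = Delta * F ^+ 2 * win p rho L N 1); last by rewrite -/F; ring.
    by apply: ler_wpM2l => //; apply: mulr_ge0 => //; lra.
  rewrite ler_pdivlMr; last by apply: mulr_gt0 => //; apply: mulr_gt0.
  have LL : L%:R ^+ 2 <= 64 * F ^+ 2.
    have : L%:R ^+ 2 <= (8 * F) ^+ 2 by rewrite lerXn2r ?nnegrE //; lra.
    by rewrite exprMn; lra.
  have -> : Delta / 2 * L%:R * e * (2 * L%:R * rho ^+ L) =
     Delta * (L%:R ^+ 2 * (e * rho ^+ L)) by field.
  rewrite ler_wpM2l //.
  apply: (@le_trans _ _ (64 * F ^+ 2 * (1 / 64))); last by lra.
  apply: (ler_pM _ _ LL e_rho); first by apply: exprn_ge0; rewrite ltW.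
  by apply: mulr_ge0; rewrite ltW.
move=> S n TS n0 n1; apply: le_trans (HD S n (2 * Delta + z) TS _) _.
  by rewrite n0 n1; lra.
rewrite n0 add0r -/rho -/dur.
have -> : p * z * dur = p * (Delta / 2) * dur / F by rewrite /z -/F; field; rewrite gt_eqF.
rewrite lerD2l lerN2; apply: ler_wpM2l; first exact: (ltW w0).
have : z * (6 * F) <= z * (L%:R - 1) by rewrite ler_wpM2l // ltW.
by have := z_le; lra.
Qed.
End TwoSubspaces.

(** * Choice of the subspaces *)

Section Selection.
Variable R : realType.

(* Small enough for [select_sizes], which needs [16 * rate <= 1 / 2] and
   [8 * ln 2 <= 1 / (432 * rate)], where 16 and 432 come from
   [two_subspaces_hard] and [uniform_hard]. *)
Definition rate : R := 1 / 4000.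

(** Telescoping, since [1 / (j + 1) ^ 2 <= 1 / j - 1 / (j + 1)]. *)
Lemma sum_inverse_squares (a : nat -> R) b K : 0 <= K ->
  (forall j, (0 < j < b)%N -> a j <= K / j.+1%:R ^+ 2) ->
  \sum_(1 <= j < b) a j <= K.
Proof.
move=> K0 Ha; case: b Ha => [_|b Ha]; first by rewrite big_geq.
suff : \sum_(1 <= j < b.+1) a j <= K * (1 - b.+1%:R^-1).
  move/le_trans; apply; rewrite ler_piMr // lerBlDr lerDl invr_ge0 //.
elim: b Ha => [|b IH] Ha; first by rewrite big_geq // invr1 subrr mulr0.
rewrite big_nat_recr //=; apply: le_trans (lerD (IH _) (Ha b.+1 _)) _.
- by move=> j /andP[j0 jb]; apply: Ha; rewrite j0 (leq_trans jb).
- by rewrite /= ltnSn.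
have b0 : 0 < b.+1%:R :> R by rewrite ltr0n.
have bE : b.+2%:R = b.+1%:R + 1 :> R by rewrite natr1.
rewrite -mulrDr; apply: ler_wpM2l => //; rewrite bE; set t := b.+1%:R in b0 *.
rewrite -subr_ge0 (_ : _ - _ = (t * (t + 1) ^+ 2)^-1).
  by rewrite invr_ge0 mulr_ge0 ?sqr_ge0 // ltW.
by field; rewrite !gt_eqF // addr_gt0.
Qed.

(* Either some first [2 ^ h] sizes are comparable, or all but the first decay so
   fast that the first one nearly equals the sum. *)
Lemma select_sizes (s : seq nat) : sorted geq s -> all (leq 1) s ->
    (1 < size s)%N ->
  (exists h, [/\ (0 < h)%N, (2 ^ h <= size s)%N &
     rate * ln (sumn s)%:R <= rate * ln (nth 0 s (2 ^ h).-1)%:R + h%:R / 432]) \/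
  rate * ln (sumn s)%:R <= rate * ln (nth 0 s 0)%:R +
    expR (- 16 * (rate * ln (nth 0 s 0)%:R - rate * ln (nth 0 s 1)%:R)) / 64.
Proof.
move=> s_sorted s_pos s_size.
have rate0 : 0 < rate by rewrite /rate; lra.
pose a j := (nth 0 s j)%:R : R; pose A := (sumn s)%:R : R.
have a_gt0 j : (j < size s)%N -> 0 < a j.
  by move=> js; rewrite ltr0n; have /allP := s_pos; apply; apply: mem_nth.
have a_anti i j : (i <= j < size s)%N -> a j <= a i.
  move=> /andP[ij js]; rewrite ler_nat.
  have geq_trans : transitive geq by move=> x y z /= xy yz; apply: leq_trans yz xy.
  have := sorted_leq_nth geq_trans (@leqnn) 0 s_sorted.
  by move=> /(_ i j); rewrite !inE (leq_ltn_trans ij js) js; apply.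
have AE : A = \sum_(0 <= j < size s) a j.
  by rewrite /A sumnE (big_nth 0) natr_sum.
have s0 : (0 < size s)%N by apply: ltnW.
have AE1 : A = a 0 + \sum_(1 <= j < size s) a j by rewrite AE big_ltn.
have rest0 : 0 <= \sum_(1 <= j < size s) a j.
  by rewrite big_nat_cond sumr_ge0 // => j /andP[/andP[_ /a_gt0/ltW]].
have A0 : 0 < A by rewrite AE1 ltr_wpDr // a_gt0.
have [?|noH] := pselect (exists h, [/\ (0 < h)%N, (2 ^ h <= size s)%N &
     rate * ln A <= rate * ln (a (2 ^ h).-1) + h%:R / 432]); [by left|right].
(* The first alternative fails for [h] the integer part of the binary logarithm of [j + 1]. This
   yields [a j * 2 ^ (8 * h) <= A], where [j + 1 < 2 ^ (h + 1) <= 2 ^ (2 * h)]. *)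
have decay j : (0 < j < size s)%N -> a j * j.+1%:R ^+ 4 <= A.
  move=> /andP[j0 js]; pose h := trunc_log 2 j.+1.
  have /andP[h1 h2] := @trunc_log_bounds 2 j.+1 isT isT.
  have h0 : (0 < h)%N by rewrite /h trunc_log_gt0.
  have hs : (2 ^ h <= size s)%N by apply: leq_trans h1 js.
  have hp : ((2 ^ h).-1 < size s)%N by rewrite prednK ?expn_gt0.
  have H : rate * ln (a (2 ^ h).-1) + h%:R / 432 < rate * ln A.
    by rewrite ltNge; apply/negP => H; apply: noH; exists h.
  have aj : a j <= a (2 ^ h).-1.
    by apply: a_anti; rewrite js andbT -ltnS prednK ?expn_gt0.
  have ln2 := ln2_le1 R.
  have : ln (a (2 ^ h).-1 * 2 ^+ (8 * h)) <= ln A.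
    rewrite lnM ?posrE ?a_gt0 ?exprn_gt0 // lnXn // mulrnA.
    have : h%:R * ln 2 <= h%:R :> R by rewrite ler_piMr.
    have -> : ln 2 *+ 8 *+ h = 8 * (h%:R * ln 2) :> R.
      by ring.
    have : 0 <= h%:R :> R by [].
    by move: H; rewrite /rate; lra.
  rewrite ler_ln ?posrE ?mulr_gt0 ?a_gt0 ?exprn_gt0 //; apply: le_trans.
  apply: (ler_pM (ltW (a_gt0 _ js)) _ aj); first by rewrite exprn_ge0.
  rewrite -!natrX ler_nat; apply: (@leq_trans ((2 ^ h.+1) ^ 4)).
    by rewrite leq_exp2r // ltnW.
  by rewrite -expnM leq_exp2l //; move: h0; clearbody h; clear; lia.
(* This is the square root of [a 1 / a 0]. *)
pose theta := expR ((ln (a 1) - ln (a 0)) / 2).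
have theta0 : 0 < theta by apply: expR_gt0.
have a00 : 0 < a 0 by apply: a_gt0. have a10 : 0 < a 1 by apply: a_gt0.
have theta2 : theta ^+ 2 * a 0 = a 1.
  rewrite /theta -expRM_natr divfK // expRD expRN !lnK ?posrE //.
  by rewrite divfK // gt_eqF.
have restA : \sum_(1 <= j < size s) a j <= A / 4.
  apply: sum_inverse_squares; first by rewrite divr_ge0 // ltW.
  move=> j /[dup] jb /decay; have j2 : 2 <= j.+1%:R :> R.
    by rewrite (ler_nat _ 2); case/andP: jb.
  set m := j.+1%:R in j2 *; move=> H.
  have m0 : 0 < m by lra.
  rewrite ler_pdivlMr ?exprn_gt0 //.
  have : a j * m ^+ 2 * 4 <= a j * m ^+ 4.
    rewrite -mulrA; apply: ler_wpM2l; first by case/andP: jb => _ /a_gt0/ltW.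
    rewrite (_ : m ^+ 4 = m ^+ 2 * m ^+ 2); last by ring.
    by apply: ler_wpM2l; [exact: sqr_ge0|nra].
  by lra.
(* Geometric mean of the bounds [a j <= a 1] and [a j <= A / (j + 1) ^ 4], with [A <= 4 * a 0]
   thanks to [restA]. *)
have rest_theta : \sum_(1 <= j < size s) a j <= 2 * theta * a 0.
  have K0 : 0 < 2 * theta * a 0 by rewrite !mulr_gt0.
  apply: sum_inverse_squares; first exact: (ltW K0).
  move=> j /[dup] jb /decay H; have /andP[j0 js] := jb.
  have aj0 := a_gt0 j js.
  have m0 : 0 < j.+1%:R :> R by rewrite ltr0n.
  set m := j.+1%:R in m0 H *.
  rewrite ler_pdivlMr ?exprn_gt0 //.
  rewrite -(@ler_pXn2r _ 2) ?nnegrE ?mulr_ge0 ?exprn_ge0 ?(ltW aj0) ?(ltW m0)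
    ?(ltW a00) ?(ltW theta0) //.
  have -> : (a j * m ^+ 2) ^+ 2 = a j * (a j * m ^+ 4) by ring.
  have -> : (2 * theta * a 0) ^+ 2 = 4 * a 0 * a 1 by rewrite -theta2; ring.
  apply: (@le_trans _ _ (a 1 * A)).
    apply: (ler_pM (ltW aj0) _ _ H); last by apply: a_anti; rewrite j0.
    by apply: mulr_ge0; [exact: (ltW aj0)|apply: exprn_ge0; exact: (ltW m0)].
  rewrite mulrC; apply: ler_wpM2r; first exact: (ltW a10).
  by move: AE1 restA; lra.
have lnA : ln A - ln (a 0) <= 2 * theta.
  rewrite -ln_div ?posrE //.
  have -> : A / a 0 = 1 + (\sum_(1 <= j < size s) a j) / a 0.
    by rewrite AE1; field; rewrite gt_eqF.
  apply: le_trans (le_ln1Dx _) _.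
    by apply: (@lt_le_trans _ _ 0); rewrite ?divr_ge0 ?(ltW a00) //; lra.
  by rewrite ler_pdivrMr.
have : theta <= expR (- 16 * (rate * ln (a 0) - rate * ln (a 1))).
  rewrite ler_expR.
  have : ln (a 1) <= ln (a 0) by rewrite ler_ln ?posrE //; apply: a_anti.
  by rewrite /rate; lra.
rewrite -/A -/(a 0) -/(a 1).
have : rate * (ln A - ln (a 0)) <= rate * (2 * theta) by rewrite ler_wpM2l // ltW.
by rewrite /rate; move: theta0; lra.
Qed.
End Selection.

(** * Hierarchically separated trees *)

Section Trees.
Variable T : rooted_tree.
Implicit Types (a b u v w x y : T).

Lemma anc_refl a : ancestor a a.
Proof. exact: connect0. Qed.

Lemma anc_trans a b (c : T) : ancestor a b -> ancestor b c -> ancestor a c.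
Proof. by move=> ab bc; apply: connect_trans bc ab. Qed.

Lemma anc_parent v : ancestor (parent v) v.
Proof. exact: fconnect1. Qed.

Lemma ancP a v : reflect (exists m, iter m (@parent T) v = a) (ancestor a v).
Proof.
apply: (iffP idP) => [av|[m <-]]; last exact: fconnect_iter.
by exists (findex (@parent T) v a); apply: iter_findex.
Qed.

Lemma anc_antisym a b : ancestor a b -> ancestor b a -> a = b.
Proof.
move=> ab ba; apply: (@is_lca_uniq T a a).
  by rewrite /is_lca anc_refl /=; apply/forallP => x; rewrite andbb implybb.
rewrite /is_lca ba /=; apply/forallP => x; rewrite andbb; apply/implyP => xa.
exact: anc_trans xa ab.
Qed.

Lemma anc_chain a b v : ancestor a v -> ancestor b v -> ancestor a b || ancestor b a.
Proof.
move=> /ancP[i <-] /ancP[j <-]; case/orP: (leq_total i j) => ij.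
  by apply/orP; right; rewrite -(subnK ij) iterD; apply: fconnect_iter.
by apply/orP; left; rewrite -(subnK ij) iterD; apply: fconnect_iter.
Qed.

Lemma anc_strict a v : ancestor a v -> a != v -> ancestor a (parent v).
Proof.
move=> /ancP[[|m] <-]; first by rewrite eqxx.
by rewrite iterSr => _; apply: fconnect_iter.
Qed.

Lemma child_anc u v : is_child u v -> ancestor v u.
Proof. by case/andP=> _ /eqP <-; apply: anc_parent. Qed.

Lemma child_nanc u v : is_child u v -> ~~ ancestor u v.
Proof.
move=> uv; apply/negP => /anc_antisym/(_ (child_anc uv)) uE.
case/andP: uv => /negP; rewrite -uE => u_root /eqP uu; apply: u_root.
have /ancP[m <-] := root_ancestor u.
by elim: m => //= m /eqP <-; rewrite uu.
Qed.

Lemma anc_child a v : ancestor a v -> a != v -> exists2 w, is_child w a & ancestor w v.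
Proof.
move=> av nav; have /ancP exm := av.
have exm' : exists m, iter m (@parent T) v == a by case: exm => m <-; exists m.
case: (ex_minnP exm') => -[/eqP va|m /eqP vm min_m].
  by rewrite -va eqxx in nav.
exists (iter m (@parent T) v); last exact: fconnect_iter.
rewrite /is_child -vm /= eqxx andbT; apply: contraT; rewrite negbK => /eqP r.
by have := min_m m; rewrite -vm /= r parent_root eqxx ltnn => /(_ isT).
Qed.

Lemma child_disj v w1 w2 x : is_child w1 v -> is_child w2 v ->
  ancestor w1 x -> ancestor w2 x -> w1 = w2.
Proof.
wlog : w1 w2 / ancestor w1 w2 => [H|w12].
  move=> c1 c2 a1 a2; case/orP: (anc_chain a1 a2) => a12; first exact: H.
  by symmetry; apply: H.
move=> c1 c2 _ _; apply/eqP; apply: contraT => n12.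
have := anc_strict w12 n12; case/andP: c2 => _ /eqP ->.
by rewrite (negbTE (child_nanc c1)).
Qed.

(** A common ancestor at or below [w1] would put [y] under both siblings; so every common ancestor
    lies strictly above [w1]. *)
Lemma lca_children v w1 w2 x y : is_child w1 v -> is_child w2 v -> w1 != w2 ->
  ancestor w1 x -> ancestor w2 y -> lca x y = v.
Proof.
move=> c1 c2 n12 a1 a2; apply: (is_lca_uniq (lcaP x y)).
rewrite /is_lca (anc_trans (child_anc c1) a1) (anc_trans (child_anc c2) a2) /=.
apply/forallP => a; apply/implyP => /andP[ax ay].
have nay : ~~ ancestor w1 y.
  by apply: contra_neqN n12 => w1y; apply: child_disj c1 c2 w1y a2.
have nw1 : a != w1 by apply: contraNneq nay => <-.
have : ancestor a w1.
  case/orP: (anc_chain ax a1) => // w1a.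
  by case/negP: nay; apply: anc_trans w1a ay.
by move/anc_strict => /(_ nw1); case/andP: c1 => _ /eqP ->.
Qed.

Lemma lcaC (x y : T) : lca x y = lca y x.
Proof.
apply: is_lca_uniq (lcaP x y) _; have /and3P[ay ax /forallP H] := lcaP y x.
by apply/and3P; split=> //; apply/forallP => a; rewrite andbC; apply: H.
Qed.

Lemma lca_anc x y a : ancestor a x -> ancestor a y -> ancestor a (lca x y).
Proof.
by move=> ax ay; have /and3P[_ _ /forallP/(_ a)] := lcaP x y; rewrite ax ay.
Qed.

Lemma anc_lcal x y : ancestor (lca x y) x. Proof. by case/and3P: (lcaP x y). Qed.
Lemma anc_lcar x y : ancestor (lca x y) y. Proof. by case/and3P: (lcaP x y). Qed.

Lemma leaf_anc v u : is_leaf v -> ancestor v u -> u = v.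
Proof.
move=> /forallP vl vu; apply/eqP; apply: contraT => uv.
have [|w wv _] := anc_child vu; first by rewrite eq_sym.
by have := vl w; rewrite wv.
Qed.

Lemma descendants_child u v : is_child u v ->
  (#|[set x | ancestor u x]| < #|[set x | ancestor v x]|)%N.
Proof.
move=> uv; apply/proper_card/properP; split.
  by apply/fintype.subsetP => x; rewrite !inE; apply: anc_trans (child_anc uv).
by exists v; rewrite !inE ?anc_refl // child_nanc.
Qed.
End Trees.

(** * The metric of an HST and the points below a vertex *)

Section HSTMetric.
Variables (R : realType) (k : R) (T : rooted_tree) (Delta : T -> R).
Variables (M : finType) (d : M -> M -> R) (leaf : M -> T).
Hypothesis k_ge1 : 1 <= k.
Hypothesis lab : hst_labelling k Delta.
Hypothesis leaf_inj : injective leaf.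
Hypothesis leafP : forall v : T, is_leaf v <-> exists x : M, leaf x = v.
Hypothesis dE : forall x y : M, d x y = Delta (lca (leaf x) (leaf y)).

Lemma Delta_ge0 v : 0 <= Delta v. Proof. by case: lab. Qed.

Lemma Delta_anc a v : ancestor a v -> Delta v <= Delta a.
Proof.
case/ancP => m <-; elim: m v => [|m IH] v //=; apply: le_trans (IH v) _.
move: (iter m _ v) => u {IH}.
have [->|u_root] := eqVneq u (root T); first by rewrite parent_root.
have [_ _ H] := lab; have := H u (parent u); rewrite /is_child u_root eqxx.
move/(_ isT)/le_trans; apply; rewrite ler_pdivrMr; last by apply: lt_le_trans k_ge1.
by rewrite ler_peMr // Delta_ge0.
Qed.

Lemma hst_refl x : d x x = 0.
Proof.
rewrite dE; have [_ H _] := lab; apply/H.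
have -> : lca (leaf x) (leaf x) = leaf x.
  by apply: anc_antisym; [exact: anc_lcal|apply: lca_anc; exact: anc_refl].
by apply/leafP; exists x.
Qed.

Lemma hst_sym x y : d x y = d y x.
Proof. by rewrite !dE lcaC. Qed.

(** The two lowest common ancestors on the right are ancestors of [y], hence comparable, and the
    higher one is an ancestor of both [x] and [z]. *)
Lemma hst_tri x y z : d x z <= d x y + d y z.
Proof.
rewrite !dE.
have := anc_chain (anc_lcar (leaf x) (leaf y)) (anc_lcal (leaf y) (leaf z)).
case/orP=> H.
  have : ancestor (lca (leaf x) (leaf y)) (lca (leaf x) (leaf z)).
    by apply: lca_anc; [exact: anc_lcal|exact: anc_trans H (anc_lcar _ _)].
  by move/Delta_anc; have := Delta_ge0 (lca (leaf y) (leaf z)); lra.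
have : ancestor (lca (leaf y) (leaf z)) (lca (leaf x) (leaf z)).
  by apply: lca_anc; [exact: anc_trans H (anc_lcal _ _)|exact: anc_lcar].
by move/Delta_anc; have := Delta_ge0 (lca (leaf x) (leaf y)); lra.
Qed.

Lemma hard_weaken S x f f' G G' : 0 < f' -> f' <= f -> G <= G' ->
  hard d S x f G -> hard d S x f' G'.
Proof.
move=> f0 ff GG [xS H]; split=> // u u0; have [D [wD tD lD uD]] := H u u0.
exists D; split=> //; first by apply: extorts_le lD; lra.
move=> S' SS'; apply: le_trans (uD S' SS') _.
by rewrite ler_wpM2l // lef_pV2 ?posrE // (lt_le_trans f0).
Qed.

Definition points v : {set M} := [set x | ancestor v (leaf x)].

Lemma points_leaf v : is_leaf v -> exists x, points v = [set x].
Proof.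
move=> vl; have /leafP[x xv] := vl; exists x; apply/setP => y.
rewrite !inE; apply/idP/eqP => [/(leaf_anc vl)|->].
  by rewrite -xv => /leaf_inj.
by rewrite xv anc_refl.
Qed.

Lemma points_dist v w1 w2 x y : is_child w1 v -> is_child w2 v -> w1 != w2 ->
  x \in points w1 -> y \in points w2 -> d x y = Delta v.
Proof. by rewrite !inE dE => c1 c2 n12 x1 y2; rewrite (lca_children c1 c2 n12 x1 y2). Qed.

Lemma points_card v : ~~ is_leaf v ->
  #|points v| = (\sum_(w | is_child w v) #|points w|)%N.
Proof.
move=> vl; rewrite -sum1_card.
have cE x : x \in points v -> exists w, is_child w v && (x \in points w).
  rewrite inE => vx; have [|w wv wx] := anc_child vx; last by exists w; rewrite wv inE.
  by apply: contraNneq vl => ->; apply/leafP; exists x.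
transitivity (\sum_(x in points v) \sum_(w | is_child w v && (x \in points w)) 1)%N.
  apply: eq_bigr => x xv; have [w /andP[wv xw]] := cE x xv.
  rewrite (big_pred1 w) // => w' /=; apply/andP/eqP => [[wv' xw']|->//].
  by move: xw xw'; rewrite !inE => xw xw'; apply: child_disj wv' wv xw' xw.
rewrite (exchange_big_dep (fun w => is_child w v)) /=; last by move=> x w _ /andP[].
apply: eq_bigr => w wv; rewrite -sum1_card; apply: eq_bigl => x.
rewrite wv /= andb_idl // !inE; exact: anc_trans (child_anc wv).
Qed.
End HSTMetric.

(** * Induction on the tree *)

Section HSTHard.
Variables (R : realType) (k : R) (T : rooted_tree) (Delta : T -> R).
Variables (M : finType) (d : M -> M -> R) (leaf : M -> T).
Hypothesis k_ge1 : 1 <= k.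
Hypothesis lab : hst_labelling k Delta.
Hypothesis leaf_inj : injective leaf.
Hypothesis leafP : forall v : T, is_leaf v <-> exists x : M, leaf x = v.
Hypothesis dE : forall x y : M, d x y = Delta (lca (leaf x) (leaf y)).
Hypothesis M_gt0 : (0 < #|M|)%N.

Let lam : R := 1 + ln #|M|%:R.
Hypothesis k_large : 870 * lam ^+ 2 <= k.

Let pts := points leaf.
Let level v : R := 1 + rate R * ln #|pts v|%:R.
Let d_refl := hst_refl lab leafP dE.
Let d_sym := hst_sym dE.
Let d_tri := hst_tri k_ge1 lab dE.

Let lnM_ge0 : 0 <= ln #|M|%:R :> R.
Proof. by rewrite ln_ge0 // ler1n. Qed.

Let lam_ge1 : 1 <= lam. Proof. by rewrite lerDl. Qed.

Let level_le (a : nat) : (0 < a)%N -> (a <= #|M|)%N ->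
  1 <= 1 + rate R * ln a%:R <= lam.
Proof.
move=> a0 aM; have ra : 0 <= ln a%:R :> R by rewrite ln_ge0 // ler1n.
have : ln a%:R <= ln #|M|%:R :> R by rewrite ler_ln ?posrE ?ltr0n // ler_nat.
by rewrite /lam /rate => H; apply/andP; split; lra.
Qed.

Lemma size_le_sumn (s : seq nat) : all (leq 1) s -> (size s <= sumn s)%N.
Proof. by elim: s => //= a s IH /andP[a1 /IH]; lia. Qed.

(** Induction on the number of vertices below [v]. The hard set [S] may use only some of the
    children, while its ratio reflects all the points below [v]: [select_sizes] ensures that the
    gain at [v] makes up for the points left out. *)
Lemma hst_hard v : exists (x : M) (S : {set M}),
  S \subset pts v /\ hard d S x (level v) (435 * lam ^+ 2 * Delta v).
Proof.
have lam1 := lam_ge1; have lnM0 := lnM_ge0.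
have lam2 : 1 <= lam ^+ 2 by rewrite exprn_ege1.
have lam2' : 0 <= 435 * lam ^+ 2 by lra.
have [m] := ubnP #|[set x | ancestor v x]|; elim: m v => // m IH v vm.
have [vl|vl] := boolP (is_leaf v).
  have [x xE] := points_leaf leaf_inj leafP vl.
  exists x, [set x]; rewrite /level /pts xE; split=> //.
  rewrite cards1 ln1 mulr0 addr0; apply: (hard_weaken ltr01 (lexx 1) _ (hard_leaf d_refl d_sym d_tri x)).
  by apply: mulr_ge0; [exact: lam2'|exact: (Delta_ge0 lab)].
have Dv : 0 < Delta v.
  rewrite lt_neqAle (Delta_ge0 lab) andbT eq_sym; apply: contraNneq vl => D0.
  by have [_ H _] := lab; apply/H.
have [g gP] : exists g : T -> M * {set M}, forall w, is_child w v ->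
    (g w).2 \subset pts w /\ hard d (g w).2 (g w).1 (level w) (435 * lam ^+ 2 * Delta w).
  have : forall w, exists p : M * {set M}, is_child w v ->
    p.2 \subset pts w /\ hard d p.2 p.1 (level w) (435 * lam ^+ 2 * Delta w).
    move=> w; have [wv|nwv] := boolP (is_child w v); last first.
      by have /card_gt0P[x _] := M_gt0; exists (x, finset.set0).
    have [|x [S HS]] := IH w; last by exists (x, S).
    by rewrite -ltnS; apply: leq_trans vm; rewrite ltnS; apply: descendants_child.
  by case/choice => g gP; exists g.
have g_sub w : is_child w v -> (g w).2 \subset pts w by case/gP.
(* Here [k] must be large: the slack of a child, proportional to [lam ^ 2], has to be at most half
   of [Delta v]. *)
have Dchild w : is_child w v -> 435 * lam ^+ 2 * Delta w <= Delta v / 2.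
  move=> wv; have [_ _ H] := lab; have := H w v wv.
  rewrite ler_pdivlMr ?(lt_le_trans ltr01) // => Dk.
  have := ler_wpM2l (Delta_ge0 lab w) k_large; lra.
have pts_gt0 w : is_child w v -> (0 < #|pts w|)%N.
  move=> wv; have [sub [gin _]] := gP w wv; apply/card_gt0P; exists (g w).1.
  exact: (fintype.subsetP sub).
have g_hard w f : is_child w v -> 0 < f -> f <= level w ->
    hard d (g w).2 (g w).1 f (Delta v / 2).
  move=> wv f0 fw; have [_ H] := gP w wv; apply: hard_weaken H => //.
  exact: Dchild.
have g_dist w1 w2 x y : is_child w1 v -> is_child w2 v -> w1 != w2 ->
    x \in (g w1).2 -> y \in (g w2).2 -> d x y = Delta v.
  move=> c1 c2 n12 x1 y2; apply: (points_dist dE c1 c2 n12).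
    exact: (fintype.subsetP (g_sub w1 c1)).
  exact: (fintype.subsetP (g_sub w2 c2)).
have g_in w : is_child w v -> (g w).2 \subset pts v.
  move=> wv; apply: fintype.subset_trans (g_sub w wv) _.
  by apply/fintype.subsetP => x; rewrite !inE; apply: anc_trans (child_anc wv).
pose cs := sort (relpre (fun w => #|pts w|) geq) (enum (fun w => is_child w v)).
have csP w : (w \in cs) = is_child w v by rewrite mem_sort mem_enum.
have cs_uniq : uniq cs by rewrite sort_uniq enum_uniq.
pose s := [seq #|pts w| | w <- cs].
have s_sorted : sorted geq s.
  rewrite sorted_map; apply: sort_sorted => w1 w2 /=; exact: leq_total.
have s_pos : all (leq 1) s.
  by apply/allP => a /mapP[w]; rewrite csP => /pts_gt0 H ->.
have s_sum : sumn s = #|pts v|.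
  rewrite (points_card leafP vl) sumnE big_map -[RHS]big_enum /=.
  by apply: perm_big; rewrite perm_sort.
have s_nth j : (j < size cs)%N -> nth 0%N s j = #|pts (nth v cs j)|.
  by move=> js; rewrite (nth_map v).
have child_nth j : (j < size cs)%N -> is_child (nth v cs j) v.
  by move=> js; rewrite -csP mem_nth.
have s_size : size s = size cs by rewrite size_map.
have s_le : (size s <= #|M|)%N.
  by apply: leq_trans (size_le_sumn s_pos) _; rewrite s_sum max_card.
have nth_le j : (j < size cs)%N -> (0 < nth 0 s j <= #|M|)%N.
  by move=> js; rewrite s_nth // pts_gt0 ?max_card // child_nth.
(* A vertex with a single child has the same points as this child, whose adversaries are kept. *)
have [cs1|cs2] := ltnP 1 (size s); last first.
  have : (0 < size cs)%N.
    move: vl; rewrite /is_leaf negb_forall => /existsP[w]; rewrite negbK -csP.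
    by case: (cs).
  rewrite -s_size.
  case: s s_size s_sum s_nth cs2 {s_sorted s_pos s_le nth_le} => // a [|//].
  move=> s_size s_sum s_nth _ _.
  have c0 : (0 < size cs)%N by rewrite -s_size.
  have wv := child_nth 0%N c0; set w := nth v cs 0 in wv.
  have [sub H] := gP w wv; exists (g w).1, (g w).2; split; first exact: g_in.
  have -> : level v = level w.
    by rewrite /level -s_sum /= addn0; have := s_nth 0%N c0; rewrite /= => ->.
  apply: hard_weaken H => //.
    have /andP[l1 _] := level_le (pts_gt0 w wv) (max_card _).
    exact: lt_le_trans ltr01 l1.
  rewrite ler_wpM2l //.
  exact: (Delta_anc k_ge1 lab (child_anc wv)).
have [[h [h0 hs H]]|H] := @select_sizes R s s_sorted s_pos cs1.
  (* The [2 ^ h] largest children, indexed by bit vectors; each is credited only with the ratio of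
     the smallest of them. *)
  pose idx (i : {ffun 'I_h -> bool}) := nth v cs (enum_rank i).
  have cardI : #|{: {ffun 'I_h -> bool}}| = (2 ^ h)%N.
    by rewrite card_ffun card_bool card_ord.
  have idx_lt (i : {ffun 'I_h -> bool}) : (enum_rank i < size cs)%N.
    by rewrite -s_size; apply: leq_trans hs; rewrite -cardI.
  have p_lt : ((2 ^ h).-1 < size cs)%N by rewrite -s_size prednK ?expn_gt0.
  have /andP[a0 aM] := nth_le _ p_lt.
  set a := nth 0%N s (2 ^ h).-1 in H a0 aM.
  have /andP[f1 f_lam] := level_le a0 aM; set f := 1 + rate R * ln a%:R in f1 f_lam.
  have f0 : 0 < f by apply: lt_le_trans f1.
  have idx_child i : is_child (idx i) v by apply: child_nth.
  have idx_hard i : hard d (g (idx i)).2 (g (idx i)).1 f (Delta v / 2).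
    apply: g_hard => //; rewrite /f /level lerD2l.
    apply: ler_wpM2l; first by rewrite /rate; lra.
    rewrite ler_ln ?posrE ?ltr0n ?pts_gt0 // ler_nat -s_nth //.
    have geq_trans : transitive geq by move=> x y z /= xy yz; apply: leq_trans yz xy.
    have := sorted_leq_nth geq_trans (@leqnn) 0 s_sorted.
    move=> /(_ (enum_rank i) (2 ^ h).-1); rewrite !inE s_size => /(_ (idx_lt i) p_lt).
    by apply; rewrite -ltnS prednK ?expn_gt0 // -cardI.
  have idx_dist i j x y : i != j -> x \in (g (idx i)).2 -> y \in (g (idx j)).2 ->
      d x y = Delta v.
    move=> ij; apply: g_dist => //; rewrite nth_uniq //.
    by apply: contra ij => /eqP/val_inj/enum_rank_inj ->.
  pose i0 : {ffun 'I_h -> bool} := [ffun=> false].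
  exists (g (idx i0)).1, (\bigcup_i (g (idx i)).2); split.
    by apply/finset.bigcupsP => i _; apply: g_in.
  have := uniform_hard d_refl d_sym d_tri i0 Dv f1 idx_hard idx_dist h0.
  apply: hard_weaken.
  - have v0 : (0 < #|pts v|)%N.
      apply: leq_trans (pts_gt0 _ (idx_child i0)) _; apply: subset_leq_card.
      by apply/fintype.subsetP => x; rewrite !inE; apply: anc_trans (child_anc (idx_child i0)).
    have /andP[l1 _] := level_le v0 (max_card _).
    exact: lt_le_trans ltr01 l1.
  - by rewrite /level -s_sum /f; move: H; lra.
  (* [432 * f ^ 2 + h + 1 <= 435 * lam ^ 2], as [f <= lam] and [2 ^ h <= #|M|] forces
     [h <= 2 * lam]. *)
  - apply: ler_wpM2r; first exact: (ltW Dv).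
    have h_lam : h%:R <= 2 * lam.
      have : ln (2 ^ h)%:R <= ln #|M|%:R :> R.
        by rewrite ler_ln ?posrE ?ltr0n ?expn_gt0 // ler_nat (leq_trans hs).
      rewrite natrX lnXn // -[ln 2 *+ h]mulr_natl => HM.
      have ln2 := ln2_ge_half R.
      have := ler_wpM2l (ler0n R h) ln2; rewrite /lam; lra.
    have : f ^+ 2 <= lam ^+ 2 by rewrite lerXn2r ?nnegrE // ltW // (lt_le_trans f0).
    have : lam <= lam ^+ 2 by rewrite expr2 ler_peMr //; lra.
    by lra.
have c0 : (0 < size cs)%N by rewrite -s_size ltnW.
have c1 : (1 < size cs)%N by rewrite -s_size.
(* Through the coercion of [~~ i] to 0 or 1, [true] stands for the largest child and [false] for the
   next one. *)
pose idx (i : bool) := nth v cs (~~ i).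
have idx_lt (i : bool) : (~~ i < size cs)%N by case: i.
have idx_child i : is_child (idx i) v by apply: child_nth.
pose f (i : bool) := level (idx i).
have f1 i : 1 <= f i <= lam by apply: level_le; rewrite ?pts_gt0 ?max_card.
have f_le : f false <= f true.
  rewrite /f /level lerD2l; apply: ler_wpM2l; first by rewrite /rate; lra.
  rewrite ler_ln ?posrE ?ltr0n ?pts_gt0 // ler_nat -!s_nth //.
  have geq_trans : transitive geq by move=> x y z /= xy yz; apply: leq_trans yz xy.
  have := sorted_leq_nth geq_trans (@leqnn) 0 s_sorted.
  by move=> /(_ 0%N 1%N); rewrite !inE s_size; apply.
have f0 i : 0 < f i by have /andP[fi _] := f1 i; apply: lt_le_trans fi.
have idx_hard i : hard d (g (idx i)).2 (g (idx i)).1 (f i) (Delta v / 2).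
  by apply: g_hard.
have idx_dist i j x y : i != j -> x \in (g (idx i)).2 -> y \in (g (idx j)).2 ->
    d x y = Delta v.
  by move=> ij; apply: g_dist => //; rewrite nth_uniq //; move: i j ij => [] [].
have /andP[ff1 _] := f1 false; have /andP[ft1 ft2] := f1 true.
exists (g (idx true)).1, (\bigcup_i (g (idx i)).2); split.
  by apply/finset.bigcupsP => i _; apply: g_in.
have := two_subspaces_hard d_refl d_sym d_tri Dv ff1 f_le idx_hard idx_dist.
apply: hard_weaken.
- have v0 : (0 < #|pts v|)%N.
    apply: leq_trans (pts_gt0 _ (idx_child true)) _; apply: subset_leq_card.
    by apply/fintype.subsetP => x; rewrite !inE; apply: anc_trans (child_anc (idx_child true)).
  have /andP[l1 _] := level_le v0 (max_card _).
  exact: lt_le_trans ltr01 l1.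
- move: H; rewrite !s_nth // s_sum.
  rewrite (_ : f true - f false = rate R * ln #|pts (nth v cs 0)|%:R
     - rate R * ln #|pts (nth v cs 1)|%:R); last by rewrite /f /level /idx /=; ring.
  by rewrite {1}/level {1}/f /level /idx /=; lra.
- apply: ler_wpM2r; first exact: (ltW Dv).
  have : f true ^+ 2 <= lam ^+ 2 by rewrite lerXn2r ?nnegrE // ltW // (lt_le_trans (f0 true)).
  by lra.
Qed.
End HSTHard.

(** * Yao's principle *)

Section Yao.
Variables (R : realType) (M : finType) (d : M -> M -> R) (S : {set M}).
Hypothesis d_refl : forall x, d x x = 0.
Hypothesis d_sym : forall x y, d x y = d y x.
Hypothesis d_tri : forall x y z, d x z <= d x y + d y z.
Implicit Types (D : adversary R M) (q : M * R) (x y z : M).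
Implicit Types (A : online_algorithm R M).
Local Open Scope ereal_scope.

Let dge0 x y : (0 <= d x y)%R. Proof. exact: d_ge0. Qed.

(* The infinite cost outside [S] confines every player to [S]. *)
Definition request q : task R M := fun y =>
  if y \in S then (`|charge q y|%R%:E)%:nng else (+oo : \bar R)%:nng.

Lemma requestE q y :
  (request q y)%:num = if y \in S then (charge q y)%:E else +oo.
Proof. by rewrite /request; case: ifP => //= _; rewrite ger0_norm ?charge_ge0. Qed.

Notation requests := (map request).

Lemma schedule_cost_ge0 x (s : seq (task R M)) p : 0 <= schedule_cost d x s p.
Proof.
elim: s x p => [|c s IH] x [|y p] //=.
by rewrite !adde_ge0 ?lee_fin.
Qed.

Lemma schedule_cost_start x y (s : seq (task R M)) p :
  schedule_cost d x s p <= (d x y)%:E + schedule_cost d y s p.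
Proof.
case: s p => [|c s] [|z p] /=; rewrite ?adde0 ?lee_fin //.
by rewrite addeA leeD2r // addeA leeD2r // -EFinD lee_fin d_tri.
Qed.

Lemma cost_OPT_ge0 x (s : seq (task R M)) : 0 <= cost_OPT d x s.
Proof. by apply: le_bigmin => // p _; apply: schedule_cost_ge0. Qed.

(** Go to [y], then follow the best player confined to [S]; the triangle inequality merges the
    initial move with her first one. *)
Lemma cost_OPT_le x y s : y \in S ->
  cost_OPT d x (requests s) <= (d x y + offline d S y s y)%:E.
Proof.
move=> yS.
have follow z : z \in S -> exists p : seq M, size p = size s /\
    schedule_cost d z (requests s) p <= (offline d S y s z)%:E.
  elim: s z => [|q s IH] z zS.
    by exists [::]; split=> //=; rewrite lee_fin.
  have [w wS ->] := offline_consP d y q s zS.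
  have [p [ps Hp]] := IH w wS; exists (w :: p); split; first by rewrite /= ps.
  by rewrite /= requestE wS !EFinD leeD2l.
have [p [ps Hp]] := follow y yS; have ps' : size p == size (requests s) by rewrite size_map ps.
apply: (@bigmin_inf _ _ _ _ (Tuple ps')) => //=.
by apply: le_trans (schedule_cost_start x y _ _) _; rewrite EFinD leeD2l.
Qed.

(** The past [h] is kept as a parameter so that induction on the remaining tasks goes through. *)
Definition positions_after A (h s : seq (task R M)) : seq M :=
  [seq A (h ++ take t.+1 s) | t <- iota 0 (size s)].

Lemma positions_after_cons A h c s :
  positions_after A h (c :: s) =
  A (rcons h c) :: positions_after A (rcons h c) s.
Proof.
rewrite /positions_after /= take0 -cats1; congr (_ :: _).
rewrite -[1%N]addn0 iotaDl -map_comp; apply: eq_map => t /=.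
by rewrite -catA.
Qed.

(** Extended-real counterpart of [expect], as a player who leaves [S] pays [+oo]. *)
Fixpoint expecte D (F : seq (M * R) -> \bar R) : \bar R :=
  match D with
  | Stop => F [::]
  | Hit q D' => expecte D' (fun s => F (q :: s))
  | Coin p D1 D2 => p%:E * expecte D1 F + (1 - p)%R%:E * expecte D2 F
  end.

Lemma expecte_EFin D (F : seq (M * R) -> R) :
  expecte D (fun s => (F s)%:E) = (expect D F)%:E.
Proof. by elim: D F => //= p D1 IH1 D2 IH2 F; rewrite IH1 IH2. Qed.

Lemma expecte_ge0 D F : wf D -> (forall s, 0 <= F s) -> 0 <= expecte D F.
Proof.
elim: D F => [|q D IH|p D1 IH1 D2 IH2] F /=; [by []|by move=> wD H; apply: IH|].
move=> /and4P[p0 p1 w1 w2] H.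
by rewrite adde_ge0 // mule_ge0 ?lee_fin ?subr_ge0 ?IH1 ?IH2.
Qed.

Lemma le_expecte D F G : wf D -> (forall s, F s <= G s) ->
  expecte D F <= expecte D G.
Proof.
elim: D F G => [|q D IH|p D1 IH1 D2 IH2] F G /=.
- by move=> _; apply.
- by move=> wD FG; apply: IH.
- move=> /and4P[p0 p1 w1 w2] FG.
  by apply: leeD; apply: lee_wpmul2l; rewrite ?lee_fin ?subr_ge0 // ?IH1 ?IH2.
Qed.

Lemma expecte_addl D F a : wf D -> 0 <= a -> (forall s, 0 <= F s) ->
  expecte D (fun s => a + F s) = a + expecte D F.
Proof.
move=> + a0; elim: D F => [|q D IH|p D1 IH1 D2 IH2] F //=; first by move=> wD H; rewrite IH.
move=> /and4P[p0 p1 w1 w2] H; rewrite IH1 // IH2 //.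
have e1 := expecte_ge0 w1 H; have e2 := expecte_ge0 w2 H.
rewrite !ge0_muleDr // addeACA; congr (_ + _).
rewrite -ge0_muleDl ?lee_fin ?subr_ge0 // -EFinD addrCA subrr addr0 mul1e //.
Qed.

(** The position chosen after a request depends only on the past, so it is one of the choices [y]
    allowed by Bellman's recursion, unless it leaves [S] and costs [+oo]. *)
Lemma online_ge A D Psi h x : wf D -> lower_bound d S D (fun=> 0%R) Psi ->
  x \in S -> (Psi x)%:E <= expecte D (fun s =>
    schedule_cost d x (requests s) (positions_after A h (requests s))).
Proof.
elim: D Psi h x => [|q D IH|p D1 IH1 D2 IH2] Psi h x /=.
- by move=> _ H xS; rewrite lee_fin H.
- move=> wD [Chi lbD H] xS; set c := request q; set y := A (rcons h c).
  have -> : (fun s => schedule_cost d x (c :: requests s)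
      (positions_after A h (c :: requests s))) =
    (fun s => ((d x y)%:E + (c y)%:num) + schedule_cost d y (requests s)
      (positions_after A (rcons h c) (requests s))).
    by apply/funext => s; rewrite positions_after_cons.
  rewrite expecte_addl //; last first.
  + by move=> s; apply: schedule_cost_ge0.
  + by rewrite adde_ge0 ?lee_fin.
  have e0 : 0 <= expecte D (fun s => schedule_cost d y (requests s)
      (positions_after A (rcons h c) (requests s))).
    by apply: expecte_ge0 => // s; apply: schedule_cost_ge0.
  rewrite requestE; case: ifP => yS; last first.
    by rewrite addey // addye ?leey //; apply: contraTneq e0 => ->.
  apply: (@le_trans _ _ (((d x y)%:E + (charge q y)%:E) + (Chi y)%:E)).
    by rewrite -!EFinD lee_fin H.
  by rewrite leeD2l // IH.
- move=> /and4P[p0 p1 w1 w2] [Psi1 [Psi2 [H1 H2 H]]] xS.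
  apply: (@le_trans _ _ (p * Psi1 x + (1 - p) * Psi2 x)%:E).
    by rewrite lee_fin H.
  rewrite EFinD !EFinM leeD // lee_wpmul2l ?lee_fin ?subr_ge0 //.
    exact: IH1.
  exact: IH2.
Qed.

Section Integral.
Variable (A : randomized_algorithm R M).
Let P := rand_prob A.

(** Every preimage is a finite union of fibers. *)
Lemma measurable_fibers (N : finType) (X : rand_space A -> N) (F : N -> \bar R) :
  (forall i, measurable [set w | X w = i]) ->
  measurable_fun setT (F \o X : rand_space A -> \bar R).
Proof.
move=> mX _ Y mY; rewrite setTI.
rewrite (_ : _ @^-1` _ = \bigcup_(i in [set i | Y (F i)]) [set w | X w = i])%classic;
  last first.
  apply/seteqP; split=> [w Yw|w [i Yi /= Xi]]; first by exists (X w).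
  by rewrite /= Xi.
by apply: fin_bigcup_measurable => //; apply: finite_finset.
Qed.

Lemma measurable_schedule_cost h s (X : rand_space A -> M) :
  (forall y, measurable [set w | X w = y]) ->
  measurable_fun setT (fun w =>
    schedule_cost d (X w) s (positions_after (rand_alg w) h s)).
Proof.
elim: s h X => [|c s IH] h X mX.
  by rewrite /=; apply: measurable_cst.
rewrite (_ : (fun w => _) = (fun w =>
   ((d (X w) (rand_alg w (rcons h c)))%:E + (c (rand_alg w (rcons h c)))%:num) +
   schedule_cost d (rand_alg w (rcons h c)) s
     (positions_after (rand_alg w) (rcons h c) s))); last first.
  by apply/funext => w; rewrite positions_after_cons.
have mY y : measurable [set w : rand_space A | rand_alg w (rcons h c) = y].
  exact: rand_measurable.
apply: emeasurable_funD; last exact: IH.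
apply: (@measurable_fibers (M * M)%type (fun w => (X w, rand_alg w (rcons h c)))
  (fun xy => (d xy.1 xy.2)%:E + (c xy.2)%:num)) => -[x y].
rewrite (_ : [set w | _] = [set w | X w = x] `&` [set w | rand_alg w (rcons h c) = y])%classic.
  exact: measurableI.
by apply/seteqP; split=> w /= => [[-> ->]|[-> ->]].
Qed.

(** The average over the adversary is a finite combination, so linearity of the integral replaces
    Fubini's theorem. *)
Lemma integral_expecte D (F : seq (M * R) -> rand_space A -> \bar R) : wf D ->
  (forall s, measurable_fun setT (F s)) -> (forall s w, 0 <= F s w) ->
  measurable_fun setT (fun w => expecte D (F ^~ w)) /\
  \int[P]_w expecte D (F ^~ w) = expecte D (fun s => \int[P]_w F s w).
Proof.
move=> + + F0; elim: D F F0 => [|q D IH|p D1 IH1 D2 IH2] F F0 /=; [by []| |].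
  by move=> wD mF; apply: (IH (fun s => F (q :: s))).
move=> /and4P[p0 p1 w1 w2] mF.
have [m1 <-] := IH1 F F0 w1 mF; have [m2 <-] := IH2 F F0 w2 mF.
have p1' : (0 <= 1 - p)%R by rewrite subr_ge0.
have mp1 : measurable_fun setT (fun w => p%:E * expecte D1 (F ^~ w)).
  exact: measurable_funeM.
have mp2 : measurable_fun setT (fun w => (1 - p)%R%:E * expecte D2 (F ^~ w)).
  exact: measurable_funeM.
split; first exact: emeasurable_funD.
rewrite ge0_integralD //; last 2 first.
- by move=> w _; rewrite mule_ge0 ?lee_fin ?expecte_ge0.
- by move=> w _; rewrite mule_ge0 ?lee_fin ?expecte_ge0.
rewrite !ge0_integralZl_EFin // => w _; exact: expecte_ge0.
Qed.
End Integral.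

(** The cost is averaged over the tosses of the adversary and of the algorithm, in either order. The
    term [d x x0] accounts for starting at [x0] instead of [x]. Since [cost_OPT] is only bounded
    from above, [r] is replaced by a nonnegative factor. *)
Lemma yao (A : randomized_algorithm R M) D x0 x (r c' m a : R) : wf D -> x \in S ->
    lower_bound d S D (fun=> 0%R) (fun=> m) -> (d x x0 <= m)%R ->
    (expect D (fun s => offline d S x s x) <= a)%R ->
    (forall s, expected_cost d x0 A s <= r%:E * cost_OPT d x0 s + c'%:E) ->
  (m - d x x0 <= Num.max r 0 * (d x0 x + a) + c')%R.
Proof.
move=> wD xS lbD dm ubD comp.
rewrite -lee_fin.
pose cost s w := schedule_cost d x0 (requests s)
  (positions_after (@rand_alg R M A w) [::] (requests s)).
have mcost s : measurable_fun setT (cost s).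
  apply: (@measurable_schedule_cost A [::] (requests s) (fun=> x0)) => y.
  have [xy|xy] := pselect (x0 = y).
    rewrite (_ : [set w | _]%classic = [set: rand_space A]%classic) //.
    by apply/seteqP; split.
  by rewrite (_ : [set w | _]%classic = classical_sets.set0) //; apply/seteqP; split.
have cost0 s w : 0 <= cost s w by apply: schedule_cost_ge0.
have [mE intE] := integral_expecte wD mcost cost0.
apply: (@le_trans _ _ (\int[rand_prob A]_w expecte D (cost ^~ w))).
  have -> : (m - d x x0)%:E = \int[rand_prob A]_w (cst (m - d x x0)%:E w).
    by rewrite integral_cst //= probability_setT mule1.
  apply: ge0_le_integral => //.
  - by move=> w _; rewrite lee_fin subr_ge0.
  - move=> w _; rewrite /= EFinB leeBlDl //.
    apply: le_trans (@online_ge (@rand_alg R M A w) D _ [::] x wD lbD xS) _.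
    rewrite -expecte_addl // ?lee_fin //; apply: le_expecte => // s.
    exact: schedule_cost_start.
rewrite intE.
apply: (@le_trans _ _ (expecte D (fun s =>
   (Num.max r 0 * (d x0 x + offline d S x s x) + c')%:E))).
  apply: le_expecte => // s; apply: le_trans (comp (requests s)) _.
  rewrite EFinD leeD2r // EFinM.
  apply: (@le_trans _ _ ((Num.max r 0)%:E * cost_OPT d x0 (requests s))).
    by rewrite lee_wpmul2r ?cost_OPT_ge0 // lee_fin le_max lexx.
  rewrite lee_wpmul2l ?cost_OPT_le // lee_fin le_max lexx orbT //.
rewrite expecte_EFin lee_fin.
rewrite (_ : (fun s => _) = (fun s => (Num.max r 0 * d x0 x + c') +
   (Num.max r 0 * offline d S x s x + 0 * 0)))%R; last by apply/funext => s; ring.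
rewrite expect_addl expect_lin mul0r addr0.
have : (Num.max r 0 * expect D (fun s => offline d S x s x) <= Num.max r 0 * a)%R.
  by apply: ler_wpM2l => //; rewrite le_max lexx orbT.
by move: (expect _ _) (Num.max r 0)%R => e rp; lra.
Qed.
End Yao.

Theorem theorem2p11 (R : realType) :
  exists C c : R, 0 < C /\ 0 < c /\
    forall (n : nat), (2 <= n)%N ->
    forall (M : finType) (d : M -> M -> R) (k : R),
      #|M| = n -> 1 <= k -> is_HST k d -> C * ln (n%:R : R) ^+ 2 <= k ->
    forall (x0 : M) (A : randomized_algorithm R M) (r : R),
      competitive d x0 A r -> c * ln (n%:R : R) <= r.
Proof.
have rate_gt0 : 0 < rate R by rewrite /rate; lra.
exists 8000, (rate R); split; first by lra.
split=> // n n2 M d k Mn k1 [T [Delta [leaf [lab leaf_inj leafP dE]]]] kn x0 A r [c' comp].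
have lnn : 1 / 2 <= ln (n%:R : R).
  apply: le_trans (ln2_ge_half R) _.
  by rewrite ler_ln ?posrE ?ltr0n ?(ltn_trans _ n2) // ler_nat.
have M0 : (0 < #|M|)%N by rewrite Mn ltnW.
(* From [ln n >= 1 / 2] follows [1 + ln n <= 3 * ln n], and [870 * 9 <= 8000]. *)
have k_large : 870 * (1 + ln (#|M|%:R : R)) ^+ 2 <= k.
  apply: le_trans kn; rewrite Mn; set l := ln _ in lnn *.
  have : (1 + l) ^+ 2 <= (3 * l) ^+ 2 by rewrite lerXn2r ?nnegrE //; lra.
  by rewrite exprMn; have := sqr_ge0 l; lra.
have [x [S [_ [xS Hhard]]]] :=
  hst_hard k1 lab leaf_inj leafP dE M0 k_large (root T).
have allM : #|points leaf (root T)| = n.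
  rewrite -Mn -cardsT; congr #|pred_of_set _|; apply/setP => y.
  by rewrite !inE; apply: root_ancestor.
rewrite allM in Hhard; set f := 1 + rate R * ln n%:R in Hhard.
have d_refl := hst_refl lab leafP dE.
have d_sym := hst_sym dE.
have d_tri := hst_tri k1 lab dE.
have f_gt : rate R * ln n%:R < f by rewrite /f ltrDr.
have rl0 : 0 < rate R * ln n%:R by rewrite mulr_gt0 //; lra.
have f0 : 0 < f by apply: lt_trans f_gt.
rewrite leNgt; apply/negP => r_lt.
set rp := Num.max r 0.
have rp_lt : rp < f by rewrite /rp gt_max f0 andbT; lra.
have rp0 : 0 <= rp by rewrite /rp le_max lexx orbT.
have main m : 0 <= m -> d x x0 <= m -> m - d x x0 <= rp * (d x0 x + m / f) + c'.
  move=> m0 dm; have [D [wD tD lD uD]] := Hhard m m0.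
  apply: (yao d_refl d_sym d_tri wD xS _ dm (uD S (subxx S)) comp).
  (* Players are confined to the hard set itself, so the condition on leaving it is vacuous. *)
  have := lD S (fun=> 0) 0 (subxx S).
  move=> /(_ _ _ _)/wrap[|||lb].
  - by move=> y z _ _; rewrite add0r (d_ge0 d_refl d_sym d_tri).
  - by [].
  - by move=> y z _ zS; rewrite zS.
  - by apply: lower_bound_le lb => y yS; rewrite /bump yS add0r.
(* The scale [m] is arbitrarily large while the other terms are fixed, which is absurd if
   [rp < f]. *)
have [K HK] : exists K, forall m, 0 <= m -> d x x0 <= m -> m * (1 - rp / f) <= K.
  exists (d x x0 + rp * d x0 x + c') => m m0 dm; have := main m m0 dm.
  by clear; lra.
have q0 : 0 < 1 - rp / f by rewrite subr_gt0 ltr_pdivrMr // mul1r.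
pose m := Num.max (Num.max (d x x0) 0) ((K + 1) / (1 - rp / f)).
have m0 : 0 <= m by rewrite /m !le_max lexx orbT.
have dm : d x x0 <= m by rewrite /m !le_max lexx.
have : K + 1 <= m * (1 - rp / f) by rewrite -ler_pdivrMr // /m le_max lexx orbT.
by have := HK m m0 dm; clear; lra.
Qed.
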